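(* Let $\mu>0$, let $A$ be exponentially distributed with parameter $\mu$ (density $\mu e^{-\mu x}$ on $[0,\infty)$), and let $B$ be a nonnegative random variable independent of $A$ with continuous distribution function $F_B$; write $\overline{F}_B=1-F_B$. Assume that $F_B\in\mathcal{M}$, i.e. there are $n\geqslant 1$ and measurable functions $g_1,\dots,g_n,h_1,\dots,h_n$ on $[0,\infty)$ with $$\overline{F}_B(x+y)=\sum_{i=1}^n g_i(x)h_i(y)\qquad\text{for all }x,y\geqslant 0,$$ and that for every $i=1,\dots,n$ the function $h_i$ is bounded on $(0,\infty)$ and $\int_0^\infty|g_i(x)|\,dx<\infty$. Let $W$ be the steady-state limit of the recursion $W_{n+1}=\max\{0,B_{n+1}-A_n-W_n\}$, with distribution function $F_W$, and put $\beta(s)=\int_0^\infty e^{-sx}\overline{F}_B(x)\,dx$ and $\gamma_i(s)=\int_0^\infty e^{-sx}g_i(x)\,dx$. Consider the following linear system of $n+1$ equations in the unknown real constants $\pi_0,c_1,\dots,c_n$: $$\pi_0+\mu\pi_0\,\beta(\mu)+\mu\sum_{i=1}^n c_i\gamma_i(\mu)=1,$$ and, for $i=1,\dots,n$, $$c_i=\mu\pi_0\int_0^\infty h_i(x)\Bigl(\overline{F}_B(x)-\mu\int_x^\infty e^{-\mu(s-x)}\overline{F}_B(s)\,ds\Bigr)dx+\mu\sum_{j=1}^n c_j\int_0^\infty h_i(x)\Bigl(g_j(x)-\mu\int_x^\infty e^{-\mu(s-x)}g_j(s)\,ds\Bigr)dx.$$ Then this system has at least one solution, and for any solution $(\pi_0,c_1,\dots,c_n)$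 the distribution of $W$ is given, for all $x\geqslant 0$, by $$F_W(x)=1-e^{\mu x}\int_x^\infty e^{-\mu s}\Bigl(\mu\pi_0\overline{F}_B(s)+\mu\sum_{i=1}^n c_i g_i(s)\Bigr)ds.$$
   Context: Let $\{A_n\}$ and $\{B_n\}$ be two mutually independent sequences of i.i.d. nonnegative random variables distributed as $A$ and $B$ respectively, and let $W_{n+1}=\max\{0,B_{n+1}-A_n-W_n\}$ for $n\geqslant 1$, with $W_1\geqslant 0$ independent of $\{A_n\}_{n\geqslant 1}$ and $\{B_n\}_{n\geqslant 2}$. Here $\mathbb{P}[B-A<0]>0$, and then the law of $W_n$ converges, irrespective of the initial state, to a unique limiting distribution; $W$ is a random variable with this distribution, and, with $W,A,B$ independent, it satisfies $W\stackrel{\mathcal{D}}{=}\max\{0,B-A-W\}$ (equality in distribution). $F_W(x)=\mathbb{P}[W\leqslant x]$. In the paper $\pi_0$ denotes the mass of $W$ at zero. The class $\mathcal{M}$ is the collection of distribution functions $F$ on $[0,\infty)$ such that, for every $x,y\geqslant 0$, $1-F(x+y)=\sum_{i=1}^n g_i(x)h_i(y)$ for some finite $n$ and some measurable functions $g_i,h_i$ (taken real-valued). *)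

(* Defs.v *)
From HB Require Import structures.
From mathcomp Require Import all_boot all_order all_algebra finmap.
From mathcomp Require Import all_classical all_reals all_analysis.

Set Implicit Arguments.
Unset Strict Implicit.
Unset Printing Implicit Defensive.

Import Order.TTheory GRing.Theory Num.Theory.
Import numFieldNormedType.Exports.

Local Open Scope classical_set_scope.
Local Open Scope ring_scope.

Section Laws.
Context (R : realType).

Definition df (d : measure_display) (T : measurableType d)
    (P : probability T R) (X : {RV P >-> R}) (x : R) : R :=
  fine (cdf X x).

(* The law of X is the set function m.  Only measurable sets are compared:
   the values of a measure on the other sets carry no meaning. *)
Definition has_law (d : measure_display) (T : measurableType d)
    (P : probability T R) (X : {RV P >-> R}) (m : set R -> \bar R) : Prop :=
  forall E : set R, measurable E -> distribution P X E = m E.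

(* The variables may live on different probability spaces. *)
Definition eq_law (d d' : measure_display)
    (T : measurableType d) (P : probability T R) (X : {RV P >-> R})
    (T' : measurableType d') (Q : probability T' R) (Y : {RV Q >-> R}) : Prop :=
  has_law X (distribution Q Y).

Definition cvg_in_law (d d' : measure_display)
    (T : measurableType d) (P : probability T R) (X : nat -> {RV P >-> R})
    (T' : measurableType d') (Q : probability T' R) (Y : {RV Q >-> R}) : Prop :=
  forall x : R, {for x, continuous (df Y)} ->
    (fun k => df (X k) x) @ \oo --> df Y x.

Definition mutual_independence (d : measure_display) (T : measurableType d)
    (P : probability T R) (I : choiceType) (X : I -> {RV P >-> R}) : Prop :=
  forall (J : {fset I}) (E : I -> set R), (forall i, measurable (E i)) ->
    P (\bigcap_(i in [set` J]) (X i @^-1` E i)) =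
    (\prod_(i <- J) P (X i @^-1` E i))%E.

Definition independent2 (d : measure_display) (T : measurableType d)
    (P : probability T R) (X Y : {RV P >-> R}) : Prop :=
  mutual_independence (fun b : bool => if b then X else Y).

End Laws.

Section Recursion.
Context (R : realType).

(* The variables that drive the recursion: the initial state W_0, the A_k, and
   the B_k with k >= 1 (B_0 never enters the recursion). *)
Definition lindley_inputs (d : measure_display) (T : measurableType d)
    (P : probability T R) (A_ B_ : nat -> {RV P >-> R}) (W0 : {RV P >-> R})
    (i : unit + (nat + nat)) : {RV P >-> R} :=
  match i with
  | inl _ => W0
  | inr (inl k) => A_ k
  | inr (inr k) => B_ k.+1
  end.

(* W_{k+1} = max(0, B_{k+1} - A_k - W_k), with indices starting at 0 instead
   of 1. *)
Definition lindley_recursion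
    (d : measure_display) (T : measurableType d) (P : probability T R)
    (A_ B_ W_ : nat -> {RV P >-> R})
    (d' : measure_display) (S : measurableType d') (Q : probability S R)
    (A B : {RV Q >-> R}) : Prop :=
  [/\ forall k, eq_law (A_ k) A,
      forall k, eq_law (B_ k.+1) B,
      mutual_independence (lindley_inputs A_ B_ (W_ 0%N)),
      {ae P, forall t, 0 <= W_ 0%N t} &
      forall k t, W_ k.+1 t = Num.max 0 (B_ k.+1 t - A_ k t - W_ k t)].

End Recursion.

Section System.
Context (R : realType).
Local Notation leb := (@lebesgue_measure R).

(* F belongs to the class M, with the decomposition given by g and h. *)
Definition class_M_decomposition (n : nat) (g h : 'I_n -> R -> R)
    (F : R -> R) : Prop :=
  [/\ forall i, measurable_fun (`[0, +oo[ : set R) (g i),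
      forall i, measurable_fun (`[0, +oo[ : set R) (h i) &
      forall x y, 0 <= x -> 0 <= y ->
        1 - F (x + y) = \sum_(i < n) g i x * h i y].

(* The Laplace transform; with f = 1 - F_B it is beta, with f = g_i it is
   gamma_i. *)
Definition laplace (f : R -> R) (s : R) : R :=
  \int[leb]_(x in `[0, +oo[) (expR (- s * x) * f x).

Definition exp_tail (mu : R) (f : R -> R) (x : R) : R :=
  f x - mu * \int[leb]_(s in `[x, +oo[) (expR (- mu * (s - x)) * f s).

(* Fbar stands for 1 - F_B. *)
Definition linear_system (mu : R) (Fbar : R -> R) (n : nat)
    (g h : 'I_n -> R -> R) (pi0 : R) (c : 'I_n -> R) : Prop :=
  pi0 + mu * pi0 * laplace Fbar mu
      + mu * \sum_(i < n) c i * laplace (g i) mu = 1 /\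
  forall i : 'I_n,
    c i = mu * pi0 * (\int[leb]_(x in `[0, +oo[) (h i x * exp_tail mu Fbar x))
        + mu * \sum_(j < n) c j *
            (\int[leb]_(x in `[0, +oo[) (h i x * exp_tail mu (g j) x)).

End System.

(* Main.v *)
Require Import Defs.
From HB Require Import structures.
From mathcomp Require Import all_boot all_order all_algebra finmap.
From mathcomp Require Import all_classical all_reals all_analysis.
From mathcomp Require Import measurable_realfun ring lra.

Set Implicit Arguments.
Unset Strict Implicit.
Unset Printing Implicit Defensive.

Import Order.TTheory GRing.Theory Num.Theory.
Import numFieldNormedType.Exports.

Local Open Scope classical_set_scope.
Local Open Scope ring_scope.

(** Write [F] for the distribution function of the limit [W] and [b] for the
    law of [B].  For nonnegative [x], the recursion says
    [P(W > x) = P(B - A - W > x)].  Averaging over the exponential [A] last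
    gives the equation [fixed_point]: [F] vanishes on the negative reals and
    [1 - F x = E (t (x + A))], where [t y = P(W <= B - y)] is [shift_avg b F y].
    It involves [F] alone, and the theorem is about its solutions.

    The limit solves it ([lindley_limit_fixed_point]).  By independence, each
    step of the recursion maps the distribution function of one variable to
    that of the next by this equation ([lindley_df_step]); dominated convergence
    passes to the limit, since [F] has countably many discontinuities and the
    atomless [b] does not see them.

    It has one bounded solution ([fixed_point_unique]).  The equation contracts
    the supremum distance: a bound [M] on the difference of two solutions
    becomes [M * P(B > x + A)], and [P(B > x + A)] stays below a constant less
    than 1.

    Its solutions are those of the linear system.  The exponential average
    [V x = E (t (x + A))] of an integrable [t] is the tail integral of the
    function [mu * (t - V)] ([integral_exp_tail]), so a solution [F] puts mass
    [F 0] at zero and has density [mu * (t - V)] on the positive reals.  Hence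
    [t y = P(B >= y + W)] equals
    [F 0 * Fbar y + \int Fbar (y + w) * (mu * (t w - V w)) dw]
    ([shift_avg_exp_avg]).  The decomposition of [Fbar] makes the integral a
    linear combination of the functions [g i], with coefficients the integrals
    of [h i] against the density.  So [t = pi0 * Fbar + \sum_i c i * g i], and
    the linear system expresses exactly that [c] is the vector of these
    coefficients and that the total mass is 1 ([linear_systemE]).  Read from [F]
    to [c], this yields a solution of the system ([fixed_point_solution]); read
    from [c] to [F], it turns any solution of the system, whatever the sign of
    the corresponding density, into a solution of the equation
    ([solution_fixed_point]), which is [F] by uniqueness. *)

(** * Integrals of real-valued functions *)

Lemma measurable_set_bool d (T : measurableType d) (b : T -> bool) :
  measurable_fun setT b -> measurable [set x | b x].
Proof.
move=> mb; have := mb measurableT [set true] I; rewrite setTI.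
by congr measurable; apply/seteqP; split => x.
Qed.

Section real_integrals.
Context d (T : measurableType d) (R : realType).
Variable m : {measure set T -> \bar R}.

Lemma integrable_bounded_mul (D : set T) (f g : T -> R) (M : R) :
  measurable D -> measurable_fun D f -> (forall x, D x -> `|f x| <= M) ->
  m.-integrable D (EFin \o g) ->
  m.-integrable D (EFin \o (fun x => f x * g x)).
Proof.
move=> mD mf fM ig.
have mg : measurable_fun D g by apply/measurable_EFinP; exact: measurable_int ig.
apply: (@le_integrable _ _ _ _ _ mD _ (fun x => M%:E * (`|g x|)%:E)%E).
- by apply/measurable_EFinP; exact: measurable_funM.
- move=> x Dx /=; rewrite lee_fin normrM [leRHS]ger0_norm.
    by rewrite ler_wpM2r// fM.
  by rewrite mulr_ge0// (le_trans _ (fM _ Dx)).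
- apply: integrableZl => //; exact: integrable_norm.
Qed.

Lemma integrable_bounded (D : set T) (f : T -> R) (M : R) :
  measurable D -> (m D < +oo)%E -> measurable_fun D f ->
  (forall x, D x -> `|f x| <= M) -> m.-integrable D (EFin \o f).
Proof.
move=> mD Dfin mf fM; apply: measurable_bounded_integrable => //.
exists M; split; first exact: num_real.
by move=> y My x Dx; exact: le_trans (fM _ Dx) (ltW My).
Qed.

Lemma integrable_scale (D : set T) (c : R) (f : T -> R) : measurable D ->
  m.-integrable D (EFin \o f) -> m.-integrable D (EFin \o (fun x => c * f x)).
Proof. by move=> mD fi; exact: (integrableZl mD c fi). Qed.

Lemma integrable_add (D : set T) (f g : T -> R) : measurable D ->
  m.-integrable D (EFin \o f) -> m.-integrable D (EFin \o g) ->
  m.-integrable D (EFin \o (fun x => f x + g x)).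
Proof. by move=> mD fi gi; exact: (integrableD mD fi gi). Qed.

Lemma integrable_sub (D : set T) (f g : T -> R) : measurable D ->
  m.-integrable D (EFin \o f) -> m.-integrable D (EFin \o g) ->
  m.-integrable D (EFin \o (fun x => f x - g x)).
Proof. by move=> mD fi gi; exact: (integrableB mD fi gi). Qed.

Lemma integrable_lincomb (D : set T) n (c : 'I_n -> R) (f : 'I_n -> T -> R) :
  measurable D -> (forall i, m.-integrable D (EFin \o f i)) ->
  m.-integrable D (EFin \o (fun x => \sum_(i < n) c i * f i x)).
Proof.
move=> mD fi.
have -> : EFin \o (fun x => \sum_(i < n) c i * f i x) =
    (fun x => \sum_(i < n) ((c i)%:E * (f i x)%:E))%E.
  by apply/funext => x /=; rewrite sumEFin.
by apply: integrable_sum => // i _; exact: (integrableZl mD (c i) (fi i)).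
Qed.

Lemma Rintegral_sum (D : set T) n (f : 'I_n -> T -> R) :
  measurable D -> (forall i, m.-integrable D (EFin \o f i)) ->
  \int[m]_(x in D) (\sum_(i < n) f i x) = \sum_(i < n) \int[m]_(x in D) f i x.
Proof.
move=> mD; elim: n f => [|n IH] f fi.
  by under eq_Rintegral do rewrite big_ord0; rewrite big_ord0 Rintegral_cst// mul0r.
under eq_Rintegral do rewrite big_ord_recr.
rewrite RintegralD//; first by rewrite big_ord_recr/= IH.
have -> : EFin \o (fun x => \sum_(i < n) f (widen_ord (leqnSn n) i) x) =
    EFin \o (fun x => \sum_(i < n) 1 * f (widen_ord (leqnSn n) i) x).
  by apply/funext => x /=; congr EFin; apply: eq_bigr => i _; rewrite mul1r.
exact: integrable_lincomb.
Qed.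

End real_integrals.

(** The inner integrals are finite almost everywhere only; the truncation of
    infinite values to 0 in the real-valued integral affects a null set. *)
Lemma Rintegral_fubini d1 d2 (T1 : measurableType d1) (T2 : measurableType d2)
    (R : realType) (m1 : {sigma_finite_measure set T1 -> \bar R})
    (m2 : {sigma_finite_measure set T2 -> \bar R}) (k : T1 * T2 -> R) :
  (m1 \x m2)%E.-integrable setT (EFin \o k) ->
  \int[m1]_x \int[m2]_y k (x, y) = \int[m2]_y \int[m1]_x k (x, y).
Proof.
move=> ik.
have H1 : (\int[m1]_x (\int[m2]_y k (x, y))%:E = \int[m1]_x \int[m2]_y (k (x, y))%:E)%E.
  apply: ae_eq_integral => //.
  - apply/measurable_EFinP; apply: measurableT_comp => //.
    exact: (measurable_fubini_F ik).
  - exact: (measurable_fubini_F ik).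
  - move: (ae_integrable1 ik); apply: filterS => x ix _.
    by rewrite /Rintegral fineK//; exact: integrable_fin_num ix.
have H2 : (\int[m2]_y (\int[m1]_x k (x, y))%:E = \int[m2]_y \int[m1]_x (k (x, y))%:E)%E.
  apply: ae_eq_integral => //.
  - apply/measurable_EFinP; apply: measurableT_comp => //.
    exact: (measurable_fubini_G ik).
  - exact: (measurable_fubini_G ik).
  - move: (ae_integrable2 ik); apply: filterS => x ix _.
    by rewrite /Rintegral fineK//; exact: integrable_fin_num ix.
by rewrite {1}/Rintegral [RHS]/Rintegral H1 H2; congr fine; exact: (Fubini ik).
Qed.

Lemma Rintegrable_fubini1 d1 d2 (T1 : measurableType d1) (T2 : measurableType d2)
    (R : realType) (m1 : {sigma_finite_measure set T1 -> \bar R})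
    (m2 : {sigma_finite_measure set T2 -> \bar R}) (k : T1 * T2 -> R) :
  (m1 \x m2)%E.-integrable setT (EFin \o k) ->
  m1.-integrable setT (EFin \o (fun x => \int[m2]_y k (x, y))).
Proof.
move=> ik; have iF := integrable_fubini_F ik.
apply: (le_integrable _ _ _ iF) => //.
  apply/measurable_EFinP; apply: measurableT_comp => //.
  exact: (measurable_fubini_F ik).
move=> x _ /=; rewrite /Rintegral /fubini_F /=.
by case: integral => [r| |] //=; rewrite normr0 leey.
Qed.

Lemma integrable_prod_dominated d1 d2 (T1 : measurableType d1) (T2 : measurableType d2)
    (R : realType) (m1 : {sigma_finite_measure set T1 -> \bar R})
    (m2 : probability T2 R) (k : T1 * T2 -> R) (f : T1 -> R) :
  measurable_fun setT k -> m1.-integrable setT (EFin \o f) ->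
  (forall x y, `|k (x, y)| <= f x) ->
  (m1 \x m2)%E.-integrable setT (EFin \o k).
Proof.
move=> mk intf kf; apply/integrable12ltyP; first exact/measurable_EFinP.
have [mf fin] := integrableP _ _ _ intf; apply: le_lt_trans fin.
apply: ge0_le_integral => //.
- by move=> x _; exact: integral_ge0.
- apply: (measurable_fun_fubini_tonelli_F (fun p => `|(EFin \o k) p|)%E) => //.
  by apply: measurableT_comp => //; exact/measurable_EFinP.
- exact: measurableT_comp.
- move=> x _; rewrite -[leRHS]mule1 -(@probability_setT _ _ _ m2) -integral_cst//.
  apply: ge0_le_integral => //.
  + apply/measurable_EFinP; apply: measurableT_comp => //.
    exact: (measurableT_comp mk (measurable_pair1 x)).
  + by move=> y _ /=; rewrite lee_fin (le_trans (kf x y))// ler_norm.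
Qed.

(** * Averages against an exponential variable *)

Section exponential_average.
Context (R : realType).
Local Notation leb := (@lebesgue_measure R).

Lemma continuous_expR_affine (c d0 : R) : continuous (fun x : R => expR (c * x + d0)).
Proof.
move=> x; apply: continuous_comp; last exact: continuous_expR.
by apply: cvgD; [apply: cvgM; [exact: cvg_cst|exact: cvg_id]|exact: cvg_cst].
Qed.

Lemma measurable_expR_affine (D : set R) (c d0 : R) :
  measurable_fun D (fun x : R => expR (c * x + d0)).
Proof.
apply: measurable_funTS; apply: continuous_measurable_fun.
exact: continuous_expR_affine.
Qed.

Lemma is_derive_expR_affine (c d0 x : R) :
  is_derive x (1 : R) (fun y : R => expR (c * y + d0)) (c * expR (c * x + d0)).
Proof.
have dl : is_derive x (1 : R) (fun y : R => c * y + d0) c.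
  by apply: is_derive_eq; rewrite addr0 /GRing.scale/= mulr1.
by rewrite mulrC; exact: is_derive1_comp.
Qed.

Lemma integral_expR_affine (c d0 a b : R) : a <= b ->
  (\int[leb]_(x in `[a, b]) (c * expR (c * x + d0))%:E =
   (expR (c * b + d0) - expR (c * a + d0))%:E)%E.
Proof.
rewrite le_eqVlt => /predU1P[->|ab].
  by rewrite set_itv1 integral_set1 subrr.
rewrite EFinB; apply: (@continuous_FTC2 _ _ (fun x => expR (c * x + d0))) => //.
- apply: continuous_subspaceT => x; apply: cvgM; first exact: cvg_cst.
  exact: continuous_expR_affine.
- split; first by move=> x _; exact: ex_derive.
  + by apply/cvg_at_right_filter; exact: continuous_expR_affine.
  + by apply/cvg_at_left_filter; exact: continuous_expR_affine.
- move=> x _; rewrite derive1E.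
  exact: (@derive_val _ _ _ _ _ _ _ (is_derive_expR_affine c d0 x)).
Qed.

(** The expectation of [t (x + A)] for [A] exponential of rate [mu].  The
    variable of integration is [x + A], so that moving [x] changes only the
    domain and a scalar factor, and the Lebesgue measure is never translated. *)
Definition exp_avg (mu : R) (t : R -> R) (x : R) : R :=
  mu * \int[leb]_(s in `[x, +oo[) (expR (- mu * (s - x)) * t s).

Lemma exp_tailE (mu : R) (t : R -> R) x : exp_tail mu t x = t x - exp_avg mu t x.
Proof. by []. Qed.

Variable mu : R.
Hypothesis mu_gt0 : 0 < mu.
Implicit Types (t : R -> R) (x y s : R).

Lemma subset_itvcy (x0 x : R) : x0 <= x -> `[x, +oo[ `<=` `[x0, +oo[.
Proof. by move=> x0x; apply: subset_itvr; rewrite bnd_simp. Qed.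

Lemma integrable_itvcy t (x0 x : R) : x0 <= x ->
  leb.-integrable `[x0, +oo[ (EFin \o t) -> leb.-integrable `[x, +oo[ (EFin \o t).
Proof. by move=> x0x; apply: integrableS => //; exact: subset_itvcy. Qed.

Lemma expR_discountE s x : expR (- mu * (s - x)) = expR (mu * x + - mu * s).
Proof. by congr expR; ring. Qed.

Lemma expR_discount_le1 s x : x <= s -> expR (- mu * (s - x)) <= 1.
Proof.
by move=> xs; rewrite -expR0 ler_expR mulNr oppr_le0 mulr_ge0 ?subr_ge0// ltW.
Qed.

Lemma measurable_expR_discount (D : set R) x :
  measurable_fun D (fun s => expR (- mu * (s - x))).
Proof.
under eq_fun do rewrite expR_discountE addrC.
exact: measurable_expR_affine.
Qed.

Lemma integrable_discounted t x :
  leb.-integrable `[x, +oo[ (EFin \o t) ->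
  leb.-integrable `[x, +oo[ (EFin \o (fun s => expR (- mu * (s - x)) * t s)).
Proof.
move=> it; apply: (@integrable_bounded_mul _ _ _ _ _ _ _ 1) => //.
  exact: measurable_expR_discount.
by move=> s /=; rewrite in_itv/= andbT => xs; rewrite ger0_norm ?expR_ge0// expR_discount_le1.
Qed.

Lemma exp_avgE t x : leb.-integrable `[x, +oo[ (EFin \o t) ->
  exp_avg mu t x = \int[leb]_(s in `[x, +oo[) (mu * expR (- mu * (s - x)) * t s).
Proof.
move=> it; rewrite /exp_avg -RintegralZl//; last exact: integrable_discounted.
by apply: eq_Rintegral => s _; rewrite mulrA.
Qed.

Lemma restrict_itvcy t (x0 s : R) : x0 <= s -> (t \_ `[x0, +oo[) s = t s.
Proof. by move=> x0s; rewrite patchT// inE/= in_itv/= andbT. Qed.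

Lemma restrict_itvcy0 t (x0 s : R) : s < x0 -> (t \_ `[x0, +oo[) s = 0.
Proof.
by move=> sx0; rewrite patchN// notin_setE/= in_itv/= andbT; apply/negP; rewrite -ltNge.
Qed.

(* On the triangle [x0 <= x <= s], integrating this kernel in [s] gives the
   average at [x]; integrating it in [x] gives [t s] times the mass that the
   exponential law puts on the segment from 0 to [s - x0]. *)
Let triangle (x0 : R) : set (R * R) := [set p | x0 <= p.1 <= p.2].

Let kern t x0 (p : R * R) : R :=
  \1_(triangle x0) p * (mu * expR (- mu * (p.2 - p.1))) * (t \_ `[x0, +oo[) p.2.

Let measurable_triangle x0 : measurable (triangle x0).
Proof.
by apply: measurable_set_bool; apply: measurable_and; exact: measurable_fun_ler.
Qed.

Let measurable_kern t x0 : measurable_fun `[x0, +oo[ t ->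
  measurable_fun setT (kern t x0).
Proof.
move=> mt; apply: measurable_funM; first apply: measurable_funM.
- exact: measurable_indic.
- by do 2 (apply: measurable_funM => //; try apply: measurableT_comp => //); exact: measurable_funB.
- have mt' : measurable_fun setT (t \_ `[x0, +oo[) by exact/(measurable_restrictT _ _).1.
  exact: (measurableT_comp mt' measurable_snd).
Qed.

Let int_kern_x t x0 s :
  (\int[leb]_x (kern t x0 (x, s))%:E =
   ((t \_ `[x0, +oo[) s * (1 - expR (- mu * (s - x0))))%:E)%E.
Proof.
have [x0s|sx0] := leP x0 s; last first.
  rewrite restrict_itvcy0// mul0r; apply: integral0_eq => x _; congr EFin.
  by rewrite /kern/= restrict_itvcy0 ?mulr0.
rewrite restrict_itvcy//.
transitivity (\int[leb]_(x in `[x0, s]) ((t s)%:E * (mu * expR (mu * x + - mu * s))%:E))%E.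
  rewrite [RHS]integral_mkcond; apply: eq_integral => x _ /=.
  rewrite /kern/= restrict_itvcy//.
  rewrite indicE patchE expR_discountE.
  have [xin|xout] := boolP (x0 <= x <= s).
    by rewrite !mem_set//= ?in_itv//= mul1r -EFinM mulrC.
  by rewrite !memNset//= ?in_itv//= ?mul0r//; exact/negP.
rewrite integralZl//; last first.
  apply: continuous_compact_integrable; first exact: segment_compact.
  apply: continuous_subspaceT => x; apply: cvgM; first exact: cvg_cst.
  exact: continuous_expR_affine.
rewrite integral_expR_affine// -EFinM mulNr subrr expR0; congr (_ * (1 - _))%:E.
by rewrite expR_discountE mulNr.
Qed.

Let int_kern_s t x0 x : leb.-integrable `[x0, +oo[ (EFin \o t) ->
  \int[leb]_s kern t x0 (x, s) = ((exp_avg mu t) \_ `[x0, +oo[) x.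
Proof.
move=> it; rewrite patchE; case: ifPn => [|].
  rewrite inE/= in_itv/= andbT => x0x.
  rewrite exp_avgE; last exact: integrable_itvcy it.
  rewrite [RHS]Rintegral_mkcond; apply: eq_Rintegral => s _.
  rewrite /kern /= indicE; have [xs|sx] := leP x s.
    by rewrite mem_set ?mul1r ?restrict_itvcy//= ?(le_trans x0x)// /triangle/= x0x.
  rewrite memNset ?mulr0n ?mul0r ?restrict_itvcy0// /triangle/= => /andP[_].
  by rewrite leNgt sx.
rewrite notin_setE/= in_itv/= andbT => /negP x0x.
rewrite -[RHS](mul0r (fine (leb setT))) -Rintegral_cst//; apply: eq_Rintegral => s _.
by rewrite /kern/= indicE memNset ?mulr0n ?mul0r// /triangle/= (negbTE x0x).
Qed.

Let integrable_kern t x0 : leb.-integrable `[x0, +oo[ (EFin \o t) ->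
  (@lebesgue_measure R \x @lebesgue_measure R)%E.-integrable setT (EFin \o kern t x0).
Proof.
move=> it.
have mt : measurable_fun `[x0, +oo[ t by apply/measurable_EFinP; exact: measurable_int it.
apply/integrable21ltyP; first by apply/measurable_EFinP; exact: measurable_kern.
have -> : (\int[leb]_s \int[leb]_x `|(EFin \o kern t x0) (x, s)|)%E =
    (\int[leb]_s (((fun s => `|t s|) \_ `[x0, +oo[) s * (1 - expR (- mu * (s - x0))))%:E)%E.
  apply: eq_integral => s _; rewrite -int_kern_x; apply: eq_integral => x _ /=.
  congr EFin; rewrite /kern/= !normrM; congr (_ * _ * _).
  - by rewrite ger0_norm// indicE; case: (_ \in _).
  - by rewrite !ger0_norm ?mulr_ge0 ?expR_ge0// ltW.
  - have [h|h] := leP x0 s; first by rewrite !restrict_itvcy.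
    by rewrite !restrict_itvcy0// normr0.
have [_ fin] := integrableP _ _ _ it; apply: le_lt_trans fin.
rewrite [leRHS]integral_mkcond; apply: ge0_le_integral => //.
- move=> s _; have [h|h] := leP x0 s; last by rewrite restrict_itvcy0// mul0r.
  by rewrite restrict_itvcy// lee_fin mulr_ge0// subr_ge0 expR_discount_le1.
- apply/measurable_EFinP; apply: measurable_funM; last first.
    by apply: measurable_funB => //; exact: measurable_expR_discount.
  by apply/(measurable_restrictT _ _).1 => //; exact: measurableT_comp.
- apply/(measurable_restrictT _ _).1 => //; apply: measurableT_comp => //.
  exact/measurable_EFinP.
- move=> s _; have [h|h] := leP x0 s; last first.
    by rewrite restrict_itvcy0// mul0r erestrict_ge0.
  rewrite restrict_itvcy// patchT; last by rewrite inE/= in_itv/= andbT.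
  by rewrite lee_fin ler_piMr// gerBl expR_ge0.
Qed.

Lemma integrable_exp_avg t x0 : leb.-integrable `[x0, +oo[ (EFin \o t) ->
  leb.-integrable `[x0, +oo[ (EFin \o exp_avg mu t).
Proof.
move=> it; apply/integrable_mkcond => //; rewrite restrict_EFin.
have := Rintegrable_fubini1 (integrable_kern it).
by congr (_.-integrable _ (EFin \o _)); apply/funext => x; rewrite int_kern_s.
Qed.

Lemma integrable_exp_tail t x0 : leb.-integrable `[x0, +oo[ (EFin \o t) ->
  leb.-integrable `[x0, +oo[ (EFin \o exp_tail mu t).
Proof.
by move=> it; apply: integrable_sub => //; exact: integrable_exp_avg.
Qed.

(** The average solves [V' = mu * (V - t)] and vanishes at infinity, which is
    this identity when [t] is continuous.  For an integrable [t], Fubini on the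
    triangle [x0 <= x <= s] replaces the differential equation. *)
Lemma integral_exp_tail t x0 : leb.-integrable `[x0, +oo[ (EFin \o t) ->
  mu * \int[leb]_(x in `[x0, +oo[) exp_tail mu t x = exp_avg mu t x0.
Proof.
move=> it; have iV := integrable_exp_avg it.
rewrite /exp_tail -/(exp_avg _ _) RintegralB//.
have -> : \int[leb]_(x in `[x0, +oo[) exp_avg mu t x =
    \int[leb]_(s in `[x0, +oo[) t s -
    \int[leb]_(s in `[x0, +oo[) (expR (- mu * (s - x0)) * t s).
  rewrite -RintegralB//; last exact: integrable_discounted.
  rewrite Rintegral_mkcond [RHS]Rintegral_mkcond.
  under eq_Rintegral do rewrite -int_kern_s//.
  rewrite Rintegral_fubini; last exact: integrable_kern.
  apply: eq_Rintegral => s _; rewrite {1}/Rintegral int_kern_x/=.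
  have [h|h] := leP x0 s; last by rewrite !restrict_itvcy0// mul0r.
  by rewrite !restrict_itvcy// mulrBr mulr1 mulrC.
by rewrite /exp_avg; ring.
Qed.

Lemma integral_exp_tail_co t u v : u <= v ->
  leb.-integrable `[u, +oo[ (EFin \o t) ->
  mu * \int[leb]_(x in `[u, v[) exp_tail mu t x = exp_avg mu t u - exp_avg mu t v.
Proof.
move=> uv it; have ie := integrable_exp_tail it.
rewrite -(integral_exp_tail it) -(integral_exp_tail (integrable_itvcy uv it)).
rewrite -mulrBr; congr (_ * _).
have uvy : `[u, +oo[%classic = `[u, v[ `|` `[v, +oo[ :> set R.
  by rewrite -itv_bndbnd_setU// bnd_simp.
rewrite [in RHS]uvy Rintegral_setU//= ?addrK// -?uvy//.
apply/disj_setPS => x /=; rewrite !in_itv/= andbT => -[/andP[_ xv]].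
by rewrite leNgt xv.
Qed.

Lemma eq_exp_avg t1 t2 x : (forall s, x <= s -> t1 s = t2 s) ->
  exp_avg mu t1 x = exp_avg mu t2 x.
Proof.
move=> t12; rewrite /exp_avg; congr (_ * _); apply: eq_Rintegral => s.
by rewrite inE/= in_itv/= andbT => xs; rewrite t12.
Qed.

Lemma exp_avg_expE t x : leb.-integrable `[x, +oo[ (EFin \o t) ->
  exp_avg mu t x = expR (mu * x) * \int[leb]_(s in `[x, +oo[) (expR (- mu * s) * (mu * t s)).
Proof.
move=> it; rewrite /exp_avg.
have ie : leb.-integrable `[x, +oo[ (EFin \o (fun s => expR (- mu * s) * t s)).
  rewrite (_ : (fun s => _) = (fun s => expR (- mu * x) * (expR (- mu * (s - x)) * t s))).
    by apply: integrable_scale => //; exact: integrable_discounted.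
  by apply/funext => s /=; rewrite mulrA -expRD; congr (expR _ * _); ring.
rewrite (_ : \int[leb]_(s in _) (expR (- mu * s) * _) =
  mu * \int[leb]_(s in `[x, +oo[) (expR (- mu * s) * t s)); last first.
  by rewrite -RintegralZl//; apply: eq_Rintegral => s _; rewrite mulrCA.
rewrite mulrCA; congr (_ * _); rewrite -RintegralZl//; apply: eq_Rintegral => s _.
by rewrite mulrA expR_discountE expRD.
Qed.

Lemma exp_avgD t1 t2 x : leb.-integrable `[x, +oo[ (EFin \o t1) ->
  leb.-integrable `[x, +oo[ (EFin \o t2) ->
  exp_avg mu (fun s => t1 s + t2 s) x = exp_avg mu t1 x + exp_avg mu t2 x.
Proof.
move=> i1 i2; rewrite /exp_avg -mulrDr -RintegralD//; try exact: integrable_discounted.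
by congr (_ * _); apply: eq_Rintegral => s _; rewrite mulrDr.
Qed.

Lemma exp_avg_sum n (c : 'I_n -> R) (t : 'I_n -> R -> R) x :
  (forall i, leb.-integrable `[x, +oo[ (EFin \o t i)) ->
  exp_avg mu (fun s => \sum_(i < n) c i * t i s) x = \sum_(i < n) c i * exp_avg mu (t i) x.
Proof.
move=> it; rewrite /exp_avg.
have id i := integrable_discounted (it i).
under [RHS]eq_bigr do rewrite mulrCA -RintegralZl//.
rewrite -mulr_sumr -Rintegral_sum//; last by move=> i; exact: integrable_scale.
congr (_ * _); apply: eq_Rintegral => s _.
by rewrite mulr_sumr; apply: eq_bigr => i _; rewrite mulrCA.
Qed.

Lemma exp_avgZ (c : R) t x : leb.-integrable `[x, +oo[ (EFin \o t) ->
  exp_avg mu (fun s => c * t s) x = c * exp_avg mu t x.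
Proof.
move=> it; rewrite /exp_avg mulrCA; congr (_ * _).
rewrite -RintegralZl//; last exact: integrable_discounted.
by apply: eq_Rintegral => s _; rewrite mulrCA.
Qed.

(** The probability that an exponential variable exceeds [m - x], when
    [x <= m]. *)
Lemma integral_discount m x :
  (\int[leb]_(s in `[m, +oo[) (mu * expR (- mu * (s - x)))%:E =
   (expR (- mu * (m - x)))%:E)%E.
Proof.
have dE s : mu * expR (- mu * (s - x)) = mu * expR (- mu * s + mu * x).
  by rewrite expR_discountE addrC.
under eq_integral do rewrite dE.
rewrite (@ge0_continuous_FTC2y _ _ (fun s => - expR (- mu * s + mu * x)) m 0).
- by rewrite -EFinB sub0r opprK expR_discountE addrC.
- by move=> s _; rewrite mulr_ge0 ?expR_ge0// ltW.
- apply: continuous_subspaceT => s; apply: cvgM; first exact: cvg_cst.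
  exact: continuous_expR_affine.
- rewrite -[X in _ --> X]oppr0; apply: cvgN.
  rewrite (_ : (fun s => _) = (fun s => expR (mu * x) * (expR (- (mu * s))))); last first.
    by apply/funext => s; rewrite addrC expRD mulNr.
  rewrite -[X in _ --> X](mulr0 (expR (mu * x))); apply: cvgM; first exact: cvg_cst.
  apply: (@cvg_comp _ _ _ (fun s => mu * s) (fun z => expR (- z)) _ (pinfty_nbhs R)).
    exact: gt0_cvgMry.
  exact: cvgr_expR.
- by move=> s _; exact: ex_derive.
- by apply/cvg_at_right_filter; apply: cvgN; exact: continuous_expR_affine.
- move=> s _; rewrite derive1E.
  have dn := is_deriveN (is_derive_expR_affine (- mu) (mu * x) s).
  by rewrite (@derive_val _ _ _ _ _ _ _ dn) mulNr opprK.
Qed.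

Lemma integrable_discount m x :
  leb.-integrable `[m, +oo[ (EFin \o (fun s => mu * expR (- mu * (s - x)))).
Proof.
apply/integrableP; split.
  apply/measurable_EFinP; apply: measurable_funM => //.
  exact: measurable_expR_discount.
under eq_integral => s _ do rewrite /= ger0_norm ?mulr_ge0 ?expR_ge0 ?ltW//.
by rewrite integral_discount ltry.
Qed.

End exponential_average.

(** * The law of B, and the fixed-point equation *)

Lemma atomless_itv_bndy (R : realType) (b : probability R R) :
  (forall y, b [set y] = 0%E) ->
  forall y, b `[y, +oo[%classic = b `]y, +oo[%classic.
Proof.
move=> b_atomless y; rewrite -(@setU1itv _ _ _ _ false)// measureU//.
  by rewrite [X in (X + _)%E](b_atomless y) add0e.
by rewrite -subset0 => z /= [->]; rewrite in_itv/= ltxx.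
Qed.

Section service_law.
Context (R : realType).
Local Notation leb := (@lebesgue_measure R).
Variable b : probability R R.
Implicit Types (F G t : R -> R) (x y s : R).

Definition surv (y : R) : R := fine (b `]y, +oo[%classic).

(** The probability that [W <= B - y], for [B] of law [b] independent of a
    variable [W] with distribution function [F]. *)
Definition shift_avg F (y : R) : R := \int[b]_s F (s - y).

Lemma surv_ge0 y : 0 <= surv y.
Proof. by rewrite fine_ge0. Qed.

Lemma surv_le1 y : surv y <= 1.
Proof. by rewrite -lee_fin fineK ?fin_num_measure// probability_le1. Qed.

Lemma surv_nonincreasing x y : x <= y -> surv y <= surv x.
Proof.
move=> xy; rewrite fine_le ?fin_num_measure// le_measure ?inE//.
exact: subset_itvr.
Qed.

Lemma measurable_surv (D : set R) : measurable_fun D surv.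
Proof.
apply: measurable_funTS.
have mN : measurable_fun setT (fun y => - surv y).
  by apply: nondecreasing_measurable => // x y xy; rewrite lerN2 surv_nonincreasing.
have -> : surv = (fun y => - - surv y) by apply/funext => y; rewrite opprK.
exact: measurableT_comp.
Qed.

Lemma surv_to0 (e : R) : 0 < e -> exists2 s0, 0 <= s0 & forall s, s0 <= s -> surv s <= e.
Proof.
move=> e0.
pose E n : set R := `]n%:R, +oo[%classic.
have cv : b (E n) @[n --> \oo] --> b (\bigcap_n E n).
  apply: nonincreasing_cvg_mu => //.
  - by rewrite (le_lt_trans (probability_le1 _ _)) ?ltry//; exact: measurable_itv.
  - by move=> n; exact: measurable_itv.
  - by apply: bigcap_measurable => // n _; exact: measurable_itv.
  - by move=> m n mn; apply/subsetPset; apply: subset_itvr; rewrite bnd_simp ler_nat.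
have E0 : \bigcap_n E n = set0.
  rewrite -subset0 => x /(_ (Num.truncn x).+1 I); rewrite /E/= in_itv/= andbT.
  by rewrite ltNge ltW// truncnS_gt.
have : surv n%:R @[n --> \oo] --> (0 : R).
  by apply/fine_cvg; rewrite E0 measure0 in cv.
move/cvgrPdist_le => /(_ _ e0)[N _ HN]; exists N%:R => // s Ns.
apply: le_trans (surv_nonincreasing Ns) _.
by have := HN N (leqnn _); rewrite /= sub0r normrN ger0_norm// surv_ge0.
Qed.

Lemma measurable_shift (F : R -> R) : measurable_fun setT F ->
  measurable_fun setT (fun p : R * R => F (p.2 - p.1)).
Proof.
move=> mF; apply: (measurableT_comp mF (g := fun p : R * R => p.2 - p.1)).
exact: measurable_funB.
Qed.

Lemma integrable_shift F y (M : R) : measurable_fun setT F -> (forall x, `|F x| <= M) ->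
  b.-integrable setT (EFin \o (fun s => F (s - y))).
Proof.
move=> mF FM; apply: (@integrable_bounded _ _ _ _ _ _ M) => //.
  by rewrite -ge0_fin_numE// fin_num_measure.
by apply: (measurableT_comp mF); exact: measurable_funB.
Qed.

Lemma measurable_shift_avg (D : set R) F (M : R) : measurable_fun setT F ->
  (forall x, `|F x| <= M) -> measurable_fun D (shift_avg F).
Proof.
move=> mF FM; apply: measurable_funTS.
have ik : (b \x b)%E.-integrable setT (EFin \o (fun p : R * R => F (p.2 - p.1))).
  apply: (@integrable_prod_dominated _ _ _ _ _ _ _ _ (fun=> M)) => //.
    exact: measurable_shift.
  exact: finite_measure_integrable_cst.
apply/measurable_EFinP; exact: measurable_int (Rintegrable_fubini1 ik).
Qed.

Hypothesis b_atomless : forall y, b [set y] = 0%E.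

(** Only [s >= y] contribute, since [F] vanishes on the negative reals; the
    endpoint [s = y] does not count because [b] has no atom. *)
Lemma shift_avg_bound F y (M : R) : measurable_fun setT F -> 
  (forall x, x < 0 -> F x = 0) -> (forall x, 0 <= x -> `|F x| <= M) ->
  `|shift_avg F y| <= M * surv y.
Proof.
move=> mF F0 FM.
have M0 : 0 <= M by rewrite (le_trans _ (FM 0 _)).
have FM' x : `|F x| <= M.
  by have [x0|x0] := leP 0 x; [exact: FM|rewrite F0// normr0].
have iF := integrable_shift y mF FM'.
have bE := atomless_itv_bndy b_atomless y.
rewrite /shift_avg; apply: (le_trans (le_normr_Rintegral measurableT iF)).
rewrite /surv -bE -(Rintegral_cst b)// [leRHS]Rintegral_mkcond.
apply: le_Rintegral => //.
- exact: (integrable_norm iF).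
- rewrite -restrict_EFin; apply: (iffLR (integrable_mkcond _ _)) => //.
  by apply: (@integrable_bounded _ _ _ _ _ _ `|M|) => //; rewrite -ge0_fin_numE// fin_num_measure.
- move=> s _; rewrite patchE; case: ifPn => [_|]; first exact: FM'.
  rewrite notin_setE/= in_itv/= andbT => /negP; rewrite -ltNge => sy.
  by rewrite F0 ?normr0// subr_lt0.
Qed.

Variable mu : R.
Hypothesis mu_gt0 : 0 < mu.

(* The set of pairs [(w, s)] with [y + w < s]; its sections have [b]-measure
   [surv (y + w)] in one direction and are the intervals below [s - y] in the
   other.  The first factor carries the measurable structure of the Lebesgue
   measure. *)
Let overshoot (y : R) : set (measurableTypeR R * R) := [set p | y + p.1 < p.2].

Let measurable_overshoot y : measurable (overshoot y).
Proof.
apply: measurable_set_bool; apply: measurable_fun_ltr => //.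
exact: measurable_funD.
Qed.

Let kern (f : R -> R) (y : R) (p : R * R) : R :=
  \1_(overshoot y) p * (f \_ `[0, +oo[) p.1.

Let kernE f y w s : kern f y (w, s) = (f \_ `[0, +oo[) w *+ (y + w < s)%R.
Proof.
rewrite /kern indicE mulr_natl; congr (_ *+ nat_of_bool _).
by apply/idP/idP; rewrite inE.
Qed.

Let integrable_kern f y : leb.-integrable `[0, +oo[ (EFin \o f) ->
  (@lebesgue_measure R \x b)%E.-integrable setT (EFin \o kern f y).
Proof.
move=> intf.
have iT : leb.-integrable setT (EFin \o (f \_ `[0, +oo[)).
  by rewrite -restrict_EFin; apply: (iffLR (integrable_mkcond _ _)).
have mT : measurable_fun setT (f \_ `[0, +oo[).
  by apply/measurable_EFinP; exact: measurable_int iT.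
apply: (@integrable_prod_dominated _ _ _ _ _ leb b (kern f y) (fun w => `|(f \_ `[0, +oo[) w|)).
- apply: measurable_funM; first exact: measurable_indic.
  exact: (measurableT_comp mT measurable_fst).
- exact: integrable_norm iT.
- by move=> w s; rewrite kernE; case: ltP => _; rewrite ?mulr1n// mulr0n normr0.
Qed.

(** Integration of a tail against a density, in the other order: given
    [B = s], the density is integrated over [0 <= w < s - y], and it is the
    derivative of minus its average. *)
Lemma integral_surv_exp_tail t y : leb.-integrable `[0, +oo[ (EFin \o t) ->
  \int[leb]_(w in `[0, +oo[) (surv (y + w) * (mu * exp_tail mu t w)) =
  \int[b]_s (if y <= s then exp_avg mu t 0 - exp_avg mu t (s - y) else 0).
Proof.
move=> it; pose f w := mu * exp_tail mu t w.
have ie := integrable_exp_tail mu_gt0 it.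
have intf : leb.-integrable `[0, +oo[ (EFin \o f) by exact: integrable_scale.
transitivity (\int[leb]_w \int[b]_s kern f y (w, s)).
  rewrite Rintegral_mkcond; apply: eq_Rintegral => w _.
  under [RHS]eq_Rintegral do rewrite kernE.
  have [w0|w0] := leP 0 w; last first.
    rewrite !restrict_itvcy0//; under eq_Rintegral do rewrite mul0rn.
    by rewrite Rintegral_cst// mul0r.
  rewrite !restrict_itvcy// mulrC /surv -(Rintegral_cst b)// Rintegral_mkcond.
  by apply: eq_Rintegral => s _; rewrite patchE mem_setE in_itv/= andbT; case: ltP.
rewrite Rintegral_fubini; last exact: integrable_kern.
apply: eq_Rintegral => s _.
have [ys|sy] := leP y s.
  rewrite -integral_exp_tail_co ?subr_ge0// -RintegralZl//; last first.
    apply: integrableS ie => //; exact: subset_itvl.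
  rewrite [RHS]Rintegral_mkcond; apply: eq_Rintegral => w _.
  rewrite kernE !patchE !mem_setE !in_itv/= andbT ltrBrDl.
  by case: (0 <= w) => //=; [case: ltP|rewrite mul0rn].
rewrite -[RHS](mul0r (fine (leb setT))) -Rintegral_cst//; apply: eq_Rintegral => w _.
rewrite kernE; have [w0|w0] := leP 0 w; last by rewrite restrict_itvcy0// mul0rn.
by rewrite ltNge (ltW (lt_le_trans sy _))// lerDl.
Qed.

Lemma exp_avg_le t1 t2 x : leb.-integrable `[x, +oo[ (EFin \o t1) ->
  leb.-integrable `[x, +oo[ (EFin \o t2) ->
  (forall s, x <= s -> t1 s <= t2 s) -> exp_avg mu t1 x <= exp_avg mu t2 x.
Proof.
move=> i1 i2 t12; rewrite /exp_avg ler_wpM2l ?(ltW mu_gt0)//.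
apply: le_Rintegral => //; try exact: integrable_discounted.
by move=> s /=; rewrite in_itv/= andbT => xs; rewrite ler_wpM2l ?expR_ge0// t12.
Qed.

Lemma exp_avg_norm t x : leb.-integrable `[x, +oo[ (EFin \o t) ->
  `|exp_avg mu t x| <= exp_avg mu (fun s => `|t s|) x.
Proof.
move=> it; rewrite /exp_avg normrM ger0_norm ?(ltW mu_gt0)// ler_wpM2l ?(ltW mu_gt0)//.
apply: le_trans (le_normr_Rintegral _ (integrable_discounted mu_gt0 it)) _ => //.
rewrite le_eqVlt; apply/orP; left; apply/eqP; apply: eq_Rintegral => s _.
by rewrite normrM (ger0_norm (expR_ge0 _)).
Qed.

Hypothesis surv_integrable : leb.-integrable `[0, +oo[ (EFin \o surv).

(** The probability that [B > x + A] is bounded away from 1 uniformly in [x]: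
    if [B] exceeds [s0] with probability at most 1/2, then with probability at
    least [expR (- mu * s0)] the variable [x + A] exceeds [s0], and given this
    [B <= x + A] has probability at least 1/2. *)
Lemma exp_avg_surv_lt1 : exists2 kappa, 0 <= kappa < 1 &
  forall x, 0 <= x -> exp_avg mu surv x <= kappa.
Proof.
have [s0 s00 Hs0] := @surv_to0 2^-1 ltac:(lra).
have k0 := expR_gt0 (- mu * s0).
have k1 : expR (- mu * s0) <= 1.
  by have := @expR_discount_le1 _ _ mu_gt0 s0 0 s00; rewrite subr0.
exists (1 - 2^-1 * expR (- mu * s0)); first lra.
move=> x x0; pose m := Num.max s0 x.
have xm : x <= m by rewrite le_max lexx orbT.
have sm : s0 <= m by rewrite le_max lexx.
pose w s := mu * expR (- mu * (s - x)).
have w0 s : 0 <= w s by rewrite mulr_ge0 ?expR_ge0// ltW.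
have iw y : leb.-integrable `[y, +oo[ (EFin \o w) := integrable_discount mu_gt0 y x.
have wE y : \int[leb]_(s in `[y, +oo[) w s = expR (- mu * (y - x)).
  by rewrite /Rintegral integral_discount.
rewrite exp_avgE//; last exact: integrable_itvcy surv_integrable.
apply: (@le_trans _ _ (1 - 2^-1 * \int[leb]_(s in `[m, +oo[) w s)); last first.
  rewrite lerD2l lerN2 ler_wpM2l// wE ler_expR !mulNr lerN2 ler_wpM2l ?(ltW mu_gt0)//.
  by rewrite lerBlDr ge_max; apply/andP; split; lra.
have w1 : 1 = \int[leb]_(s in `[x, +oo[) w s by rewrite wE subrr mulr0 expR0.
rewrite [X in _ <= X - _]w1.
have sub : (`[m, +oo[ : set R) `<=` `[x, +oo[ by exact: subset_itvcy.
have -> : \int[leb]_(s in `[m, +oo[) w s = \int[leb]_(s in `[x, +oo[) (w \_ `[m, +oo[) s.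
  by rewrite -Rintegral_mkcondr setIidr.
have iwm : leb.-integrable `[x, +oo[ (EFin \o (w \_ `[m, +oo[)).
  rewrite -restrict_EFin; apply: (iffLR (integrable_restrict _ _ _ _)) => //.
  by rewrite setIidr.
rewrite -RintegralZl// -RintegralB//; last exact: integrable_scale.
have half_sub (v : R) : v * 2^-1 <= v - 2^-1 * v by lra.
apply: le_Rintegral => //.
- have := integrable_discounted mu_gt0 (integrable_itvcy x0 surv_integrable).
  move=> /(integrableZl _ mu) => /(_ (measurable_itv _)).
  by congr (_.-integrable _ _); apply/funext => s /=; rewrite -EFinM mulrA.
- by apply: integrable_sub => //; exact: integrable_scale.
- move=> s _; rewrite -[leLHS]/(w s * surv s); have [ms|sm'] := leP m s.
    rewrite restrict_itvcy//; apply: le_trans _ (half_sub _).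
    by rewrite ler_wpM2l// Hs0// (le_trans sm).
  by rewrite restrict_itvcy0// mulr0 subr0 ler_piMr// surv_le1.
Qed.

(** The equation [W = max(0, B - A - W)] in law, in terms of the distribution
    function.  Bounded functions are allowed, not only distribution functions:
    the solutions built from the linear system come from signed densities. *)
Definition fixed_point F : Prop :=
  [/\ measurable_fun setT F, exists M, forall x, `|F x| <= M,
      forall x, x < 0 -> F x = 0 &
      forall x, 0 <= x -> 1 - F x = exp_avg mu (shift_avg F) x].

Lemma shift_avg_integrable F : fixed_point F ->
  leb.-integrable `[0, +oo[ (EFin \o shift_avg F).
Proof.
move=> [mF [M FM] F0 _].
have iM : leb.-integrable `[0, +oo[ (EFin \o (fun s => M * surv s)).
  exact: integrable_scale.
apply: (le_integrable _ _ _ iM) => //.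
- by apply/measurable_EFinP; exact: measurable_shift_avg FM.
- move=> s _ /=; rewrite lee_fin (le_trans _ (ler_norm _))//.
  by apply: shift_avg_bound => // x _; exact: FM.
Qed.

(** The difference [D] of two solutions satisfies
    [D x = - E (D (B - A - x); B >= A + x)], hence loses a factor [k < 1] in
    supremum norm at each use of the equation. *)
Lemma fixed_point_unique F G : fixed_point F -> fixed_point G -> F =1 G.
Proof.
move=> fF fG; have iF := shift_avg_integrable fF; have iG := shift_avg_integrable fG.
have [mF [M FM] F0 FE] := fF; have [mG [N GN] G0 GE] := fG.
have [k /andP[k0 k1] Hk] := exp_avg_surv_lt1.
pose D x := F x - G x.
have mD : measurable_fun setT D by exact: measurable_funB.
have D0 x : x < 0 -> D x = 0 by move=> x0; rewrite /D F0// G0// subrr.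
have shD y : shift_avg D y = shift_avg F y + -1 * shift_avg G y.
  rewrite mulN1r /shift_avg -RintegralB//.
    exact: integrable_shift FM.
  exact: integrable_shift GN.
have iD : leb.-integrable `[0, +oo[ (EFin \o shift_avg D).
  have -> : shift_avg D = (fun y => shift_avg F y + -1 * shift_avg G y) by apply/funext.
  by apply: integrable_add => //; exact: integrable_scale.
have DE x : 0 <= x -> D x = - exp_avg mu (shift_avg D) x.
  move=> x0; have ix := integrable_itvcy x0; have iGx := ix _ iG.
  have -> : shift_avg D = (fun y => shift_avg F y + -1 * shift_avg G y) by apply/funext.
  rewrite exp_avgD//; [|exact: ix|exact: integrable_scale].
  by rewrite exp_avgZ// -FE// -GE// /D; ring.
have DM n x : 0 <= x -> `|D x| <= (M + N) * k ^+ n.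
  elim: n x => [|n IH] x x0.
    by rewrite expr0 mulr1 (le_trans (ler_normB _ _))// lerD.
  rewrite DE// normrN; have iDx := integrable_itvcy x0 iD.
  apply: le_trans (exp_avg_norm iDx) _.
  have ix := integrable_itvcy x0 surv_integrable.
  apply: (@le_trans _ _ (exp_avg mu (fun s => ((M + N) * k ^+ n) * surv s) x)).
    apply: exp_avg_le => //; first exact: integrable_norm.
      exact: integrable_scale.
    move=> s xs; apply: shift_avg_bound => //.
  rewrite exp_avgZ// exprSr [leRHS]mulrA ler_wpM2l//; last exact: Hk.
  by rewrite (le_trans _ (IH 0 _)).
move=> x; apply/eqP; rewrite -subr_eq0 -/(D x).
have [x0|x0] := leP 0 x; last by rewrite D0.
rewrite -normr_le0; apply/ler_addgt0Pl => e e0; rewrite addr0.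
have : (M + N) * k ^+ n @[n --> \oo] --> (0 : R).
  rewrite -[X in _ --> X](mulr0 (M + N)); apply: cvgM; first exact: cvg_cst.
  by apply: cvg_expr; rewrite ger0_norm.
move/cvgrPdist_le => /(_ _ e0)[n _ Hn]; have := Hn n (leqnn _).
rewrite /= sub0r normrN; apply: le_trans; apply: le_trans (DM n x x0) (ler_norm _).
Qed.

End service_law.

(** * Independence *)

Section independence.
Context d (T : measurableType d) (R : realType) (P : probability T R).
Context (I : choiceType).
Variable X : I -> {RV P >-> R}.

Let update (j : I) (D : set R) (E : I -> set R) (i : I) : set R := if i == j then D else E i.

Let bigcap_update (j : I) (J : {fset I}) (D : set R) (E : I -> set R) : j \notin J ->
  \bigcap_(i in [set` (j |` J)%fset]) (X i @^-1` update j D E i) =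
  X j @^-1` D `&` \bigcap_(i in [set` J]) (X i @^-1` E i).
Proof.
move=> jJ; apply/seteqP; split => t.
  move=> Ct; split; first by have := Ct j; rewrite /= fset1U1 /update eqxx; apply.
  move=> i /= iJ; have := Ct i; rewrite /= in_fset1U iJ orbT /update.
  by case: eqP => [ij|_]; [rewrite -ij iJ in jJ|apply].
move=> [/= Xt Ct] i /=; rewrite in_fset1U => /orP[/eqP->|iJ].
  by rewrite /update eqxx.
rewrite /update; case: eqP => [->//|_]; exact: Ct.
Qed.

Let prod_update (j : I) (J : {fset I}) (D : set R) (E : I -> set R) : j \notin J ->
  (\prod_(i <- (j |` J)%fset) P (X i @^-1` update j D E i) =
   P (X j @^-1` D) * \prod_(i <- J) P (X i @^-1` E i))%E.
Proof.
move=> jJ; rewrite big_fsetU1//= {1}/update eqxx; congr (_ * _)%E.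
apply: eq_big_seq => i iJ; rewrite /update; case: eqP => // ij.
by rewrite -ij iJ in jJ.
Qed.

(** The variable [Y] and the inputs with index in [S] are jointly independent.
    Rectangles suffice: the recursion consumes one input at a time, and each
    step needs product measures of two laws only. *)
Definition indep_of (Y : {RV P >-> R}) (S : I -> Prop) : Prop :=
  forall (J : {fset I}) (E : I -> set R) (D : set R),
    (forall i, i \in J -> S i) -> (forall i, measurable (E i)) -> measurable D ->
    P (Y @^-1` D `&` \bigcap_(i in [set` J]) (X i @^-1` E i)) =
    (P (Y @^-1` D) * \prod_(i <- J) P (X i @^-1` E i))%E.

(** On a fixed cylinder [C] of other inputs, the joint law of [(Y, X j)]
    restricted to [C] and the product of the laws scaled by [P C] agree on
    rectangles, hence everywhere. *)
Lemma indep_of_joint_cylinder (Y : {RV P >-> R}) (S : I -> Prop) (j : I)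
    (J : {fset I}) (E : I -> set R) (U : set (R * R)) :
  indep_of Y S -> S j -> (forall i, i \in J -> S i /\ i <> j) ->
  (forall i, measurable (E i)) -> measurable U ->
  P ([set t | U (Y t, X j t)] `&` \bigcap_(i in [set` J]) (X i @^-1` E i)) =
  ((distribution P Y \x distribution P (X j)) U * \prod_(i <- J) P (X i @^-1` E i))%E.
Proof.
move=> indY Sj SJ mE mU.
set C := \bigcap_(i in _) _.
have mXE i E' : measurable E' -> measurable (X i @^-1` E').
  by move=> mE'; exact: measurable_funPTI.
have mC : measurable C.
  by apply: fin_bigcap_measurable => // i _; exact: mXE.
set p := (\prod_(i <- J) _)%E.
have pE : P C = p.
  have := indY J E setT _ mE measurableT.
  by rewrite preimage_setT setTI probability_setT mul1e; apply => i /SJ[].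
have pfin : p \is a fin_num by rewrite -pE fin_num_measure.
have p0 : 0 <= fine p by rewrite fine_ge0// -pE.
pose c : {nonneg R} := NngNum p0.
have cE : (c%:num)%:E = p by rewrite /= fineK.
pose YX t := (Y t, X j t).
have mYX : measurable_fun setT YX by apply: measurable_fun_pair; exact: measurable_funPT.
pose m' : {measure set (R * R) -> \bar R} := pushforward (mrestr P mC) YX.
have rect D1 D2 : measurable D1 -> measurable D2 ->
    P (YX @^-1` (D1 `*` D2) `&` C) = (p * P (Y @^-1` D1) * P (X j @^-1` D2))%E.
  move=> mD1 mD2.
  have jJ : j \notin J by apply/negP => /SJ[].
  have -> : YX @^-1` (D1 `*` D2) `&` C =
      Y @^-1` D1 `&` \bigcap_(i in [set` (j |` J)%fset]) (X i @^-1` update j D2 E i).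
    by rewrite bigcap_update// setIA.
  rewrite indY//.
  - by rewrite prod_update// [in RHS]muleAC [RHS]muleC [(p * _)%E]muleC.
  - by move=> i; rewrite in_fset1U => /orP[/eqP->//|/SJ[]].
  - by move=> i; rewrite /update; case: ifP.
have E1 : (mscale c (distribution P Y) \x distribution P (X j))%E U = m' mYX U.
  apply: product_measure_unique => // D1 D2 mD1 mD2.
  by rewrite -[LHS]/(P (YX @^-1` (D1 `*` D2) `&` C)) rect// -cE.
have E2 : (mscale c (distribution P Y) \x distribution P (X j))%E U =
    mscale c (distribution P Y \x distribution P (X j))%E U.
  apply: product_measure_unique => // D1 D2 mD1 mD2.
  rewrite -[LHS]/((c%:num)%:E * (distribution P Y \x distribution P (X j))%E (D1 `*` D2))%E.
  by rewrite product_measure1E// muleA.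
transitivity (m' mYX U) => //.
by rewrite -E1 E2 -cE muleC.
Qed.

Lemma indep_of_joint (Y : {RV P >-> R}) (S : I -> Prop) (j : I) (U : set (R * R)) :
  indep_of Y S -> S j -> measurable U ->
  P [set t | U (Y t, X j t)] = (distribution P Y \x distribution P (X j))%E U.
Proof.
move=> indY Sj mU.
have := indep_of_joint_cylinder (J := fset0) (E := fun=> setT) indY Sj _ _ mU.
rewrite big_seq_fset0 mule1 => <- //.
by rewrite (_ : \bigcap_(i in _) _ = setT) ?setIT//; apply/seteqP; split => // t _ i.
Qed.

(** An input absorbed into the variable is no longer independent of it, the
    others still are. *)
Lemma indep_of_step (Y Z : {RV P >-> R}) (S : I -> Prop) (j : I) (phi : R * R -> R) :
  measurable_fun setT phi -> (forall t, Z t = phi (Y t, X j t)) ->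
  indep_of Y S -> S j -> indep_of Z (fun i => S i /\ i <> j).
Proof.
move=> mphi ZE indY Sj J E D SJ mE mD.
have mU : measurable (phi @^-1` D) by rewrite -[X in measurable X]setTI; exact: mphi.
have ZU : Z @^-1` D = [set t | (phi @^-1` D) (Y t, X j t)].
  by apply/seteqP; split => t /=; rewrite ZE.
by rewrite ZU (indep_of_joint_cylinder indY)// (indep_of_joint indY).
Qed.

Lemma indep_of_sub (Y : {RV P >-> R}) (S S' : I -> Prop) :
  (forall i, S' i -> S i) -> indep_of Y S -> indep_of Y S'.
Proof. by move=> SS' indY J E D SJ; apply: indY => i /SJ/SS'. Qed.

Lemma mutual_independence_indep_of (j : I) (S : I -> Prop) :
  mutual_independence X -> ~ S j -> indep_of (X j) S.
Proof.
move=> indX Sj J E D SJ mE mD.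
have jJ : j \notin J by apply/negP => /SJ.
rewrite -bigcap_update// -prod_update//; apply: indX => i.
by rewrite /update; case: ifP.
Qed.

End independence.

(** * Survival functions of differences *)

Section convolutions.
Context (R : realType).
Local Notation leb := (@lebesgue_measure R).

Definition cdfm (m : probability R R) (x : R) : R := fine (m `]-oo, x]%classic).

Lemma cdfm_ge0 m x : 0 <= cdfm m x.
Proof. by rewrite fine_ge0. Qed.

Lemma cdfm_le1 m x : cdfm m x <= 1.
Proof. by rewrite -lee_fin fineK ?fin_num_measure// probability_le1. Qed.

Lemma cdfm_norm m x : `|cdfm m x| <= 1.
Proof. by rewrite ger0_norm ?cdfm_ge0// cdfm_le1. Qed.

Lemma cdfm_nondecreasing m x y : x <= y -> cdfm m x <= cdfm m y.
Proof.
move=> xy; rewrite fine_le ?fin_num_measure// le_measure ?inE//.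
exact: subset_itvl.
Qed.

Lemma measurable_cdfm m (D : set R) : measurable_fun D (cdfm m).
Proof.
by apply: measurable_funTS; apply: nondecreasing_measurable => // x y /cdfm_nondecreasing.
Qed.

Lemma survE m x : surv m x = 1 - cdfm m x.
Proof.
rewrite /surv /cdfm -setCitvl probability_setC//.
by rewrite fineB ?fin_num_measure.
Qed.

Lemma measurable_gt_sub (y : R) : measurable [set p : R * R | y < p.2 - p.1].
Proof.
by apply: measurable_set_bool; apply: measurable_fun_ltr => //; exact: measurable_funB.
Qed.

Lemma measurable_lt_sub (x : R) : measurable [set p : R * R | x < p.1 - p.2].
Proof.
by apply: measurable_set_bool; apply: measurable_fun_ltr => //; exact: measurable_funB.
Qed.

(** Since [b] has no atom, [B - W > y] and [W <= B - y] have the same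
    probability; the distribution function of [W] then appears without left
    limits. *)
Lemma product_gt_sub (m b : probability R R) (y : R) : (forall z, b [set z] = 0%E) ->
  ((m \x b) [set p | (y < p.2 - p.1)%R] = (shift_avg b (cdfm m) y)%:E)%E.
Proof.
move=> b_atomless.
have bE := atomless_itv_bndy b_atomless.
pose U : set (R * R) := [set p | y <= p.2 - p.1].
have mU : measurable U.
  by apply: measurable_set_bool; apply: measurable_fun_ler => //; exact: measurable_funB.
transitivity (\int[m]_w \int[b]_s (\1_U (w, s))%:E)%E.
  apply: eq_integral => w _ /=.
  rewrite (_ : xsection _ _ = `]y + w, +oo[%classic); last first.
    by apply/seteqP; split => s; rewrite /xsection/= inE/= in_itv/= andbT ltrBrDr.
  rewrite -bE -[X in b X]setIT -integral_indic//; apply: eq_integral => s _.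
  congr EFin; rewrite !indicE; congr (nat_of_bool _)%:R.
  by apply/idP/idP; rewrite !inE /U/= in_itv/= andbT lerBrDr.
rewrite (fubini_tonelli (fun p => (\1_U p)%:E))//=; last first.
  by apply/measurable_EFinP; exact: measurable_indic.
have E s : (\int[m]_w (\1_U (w, s))%:E = (cdfm m (s - y))%:E)%E.
  rewrite /cdfm fineK ?fin_num_measure// -[X in m X]setIT -integral_indic//.
  apply: eq_integral => w _; congr EFin; rewrite !indicE; congr (nat_of_bool _)%:R.
  by apply/idP/idP; rewrite !inE /U/= in_itv/= lerBrDr lerBrDl.
under eq_integral do rewrite E.
rewrite /shift_avg /Rintegral fineK//.
apply: integrable_fin_num => //.
exact: (integrable_shift b y (@measurable_cdfm m _) (cdfm_norm m)).
Qed.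

Variable mu : R.
Hypothesis mu_gt0 : 0 < mu.

Lemma integral_expR_decay (d0 a b : R) : a <= b ->
  (\int[leb]_(s in `[a, b[) (mu * expR (- mu * s + d0))%:E =
   (expR (- mu * a + d0) - expR (- mu * b + d0))%:E)%E.
Proof.
move=> ab; rewrite integral_itv_bndo_bndc; last first.
  apply/measurable_EFinP; apply: measurable_funM => //; exact: measurable_expR_affine.
rewrite (_ : (fun s => _) = (fun s => (-1)%:E * (- mu * expR (- mu * s + d0))%:E)%E); last first.
  by apply/funext => s; rewrite -EFinM; congr EFin; ring.
rewrite integralZl//; last first.
  apply: continuous_compact_integrable; first exact: segment_compact.
  apply: continuous_subspaceT => x; apply: cvgM; first exact: cvg_cst.
  exact: continuous_expR_affine.
by rewrite integral_expR_affine// -EFinM mulN1r opprB.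
Qed.

Lemma exponential_prob_itvNyo (t : R) :
  (exponential_prob mu `]-oo, t[ =
   (if (0 <= t)%R then 1 - expR (- mu * t) else 0)%:E)%E.
Proof.
have [t0|t0] := leP 0 t; last first.
  rewrite /exponential_prob; apply: integral0_eq => s /=; rewrite in_itv/= => st.
  by rewrite lt0_exponential_pdf// (lt_trans st).
transitivity (\int[leb]_(s in `]-oo, t[)
    (((EFin \o (fun s => mu * expR (- mu * s)%R)%R) \_ `[0%R, +oo[) s))%E.
  by rewrite restrict_EFin.
rewrite -integral_mkcondr.
rewrite (_ : _ `&` _ = `[0, t[%classic); last first.
  by apply/seteqP; split => s /=; rewrite !in_itv/= andbT; [case=> -> ->|move=> /andP[-> ->]].
have := integral_expR_decay 0 t0; rewrite mulr0 !addr0 expR0 => <-.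
by apply: eq_integral => s _; rewrite addr0.
Qed.

(** For [A] exponential, [P(Y - A > x)] is the exponential average of the
    survival function of [Y] at [x]: write [P(A < Y - x)] as the integral of the
    exponential density shifted by [x] and exchange. *)
Lemma product_exponential_gt_sub (m e : probability R R) (x : R) :
  (forall E : set R, measurable E -> e E = exponential_prob mu E) ->
  ((m \x e) [set p | (x < p.1 - p.2)%R] = (exp_avg mu (surv m) x)%:E)%E.
Proof.
move=> eE.
pose k (p : R * R) : R := (mu * expR (- mu * (p.2 - x))) *+ (x <= p.2 < p.1)%R.
have k0 p : 0 <= k p by rewrite /k mulrn_wge0// mulr_ge0 ?expR_ge0// ltW.
transitivity (\int[m]_y \int[leb]_s (k (y, s))%:E)%E.
  apply: eq_integral => y _ /=.
  rewrite (_ : xsection _ _ = `]-oo, y - x[%classic); last first.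
    by apply/seteqP; split => s; rewrite /xsection/= inE/= in_itv/= ltrBrDl ltrBrDr.
  rewrite eE// exponential_prob_itvNyo.
  rewrite subr_ge0; have [xy|yx] := leP x y; last first.
    rewrite integral0_eq// => s _; rewrite /k/=; case: andP => // -[xs].
    by move=> /(le_lt_trans xs); rewrite ltNge ltW.
  have := integral_expR_decay (mu * x) xy.
  rewrite mulNr addNr expR0 (_ : - mu * (y - x) = - mu * y + mu * x); last by ring.
  move=> <-; rewrite integral_mkcond; apply: eq_integral => s _.
  rewrite patchE mem_setE in_itv/= /k/=; case: ifP => //= _.
  by rewrite mulr1n expR_discountE addrC.
rewrite [LHS](fubini_tonelli (m1 := m) (m2 := leb) (fun p => (k p)%:E)); last 2 first.
- apply/measurable_EFinP.
  have -> : k = (fun p => (mu * expR (- mu * (p.2 - x))) * \1_[set p : R * R | x <= p.2 < p.1] p).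
    apply/funext => p; rewrite /k indicE -mulr_natr; congr (_ * (nat_of_bool _)%:R).
    by apply/idP/idP; rewrite inE.
  apply: measurable_funM; last first.
    apply: measurable_indic; apply: measurable_set_bool.
    by apply: measurable_and; [exact: measurable_fun_ler|exact: measurable_fun_ltr].
  by do 2 (apply: measurable_funM => //; try apply: measurableT_comp => //); exact: measurable_funB.
- by move=> p; rewrite lee_fin.
have sE s : (\int[m]_y (k (y, s))%:E =
   ((fun s => mu * (expR (- mu * (s - x)) * surv m s)) \_ `[x, +oo[ s)%:E)%E.
  have [xs|sx] := leP x s; last first.
    rewrite restrict_itvcy0//; apply: integral0_eq => y _.
    by rewrite /k/= leNgt sx.
  rewrite restrict_itvcy// mulrA EFinM /surv fineK ?fin_num_measure//.
  rewrite -[X in m X]setIT -integral_indic// -ge0_integralZl//; last 2 first.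
  - by apply/measurable_EFinP; exact: measurable_indic.
  - by rewrite lee_fin mulr_ge0 ?expR_ge0// ltW.
  apply: eq_integral => y _; rewrite -EFinM indicE /k/= xs -mulr_natr.
  congr (_ * (nat_of_bool _)%:R)%:E; apply/idP/idP; rewrite inE/= in_itv/= andbT//.
under eq_integral do rewrite sE.
have ig : leb.-integrable `[x, +oo[ (EFin \o (fun s => expR (- mu * (s - x)) * surv m s)).
  rewrite (_ : (fun s => _) =
      (fun s => mu^-1 * (surv m s * (mu * expR (- mu * (s - x)))))); last first.
    by apply/funext => s; field; rewrite gt_eqF.
  apply: integrable_scale => //; apply: (@integrable_bounded_mul _ _ _ _ _ _ _ 1) => //.
  - exact: measurable_surv.
  - by move=> s _; rewrite ger0_norm ?surv_ge0// surv_le1.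
  - exact: integrable_discount.
rewrite /exp_avg -RintegralZl// Rintegral_mkcond /Rintegral fineK//.
set h := (fun s => mu * _).
have ih : leb.-integrable setT (EFin \o (h \_ `[x, +oo[)); last exact: integrable_fin_num ih.
rewrite -restrict_EFin; by apply: (iffLR (integrable_mkcond _ _)) => //; exact: integrable_scale.
Qed.

End convolutions.

(** * Continuity points of distribution functions *)

Section distribution_functions.
Context (R : realType).
Local Notation leb := (@lebesgue_measure R).

Lemma atomless_countable_negligible (b : probability R R) (A : set R) :
  (forall y, b [set y] = 0%E) -> countable A -> b.-negligible A.
Proof.
move=> b0 /countable_injP[f injf].
apply: (@negligibleS _ _ _ _ (\bigcup_n [set x | A x /\ f x = n])).
  by move=> x Ax; exists (f x).
apply: negligible_bigcup => n.
have [[x [Ax fx]]|nx] := pselect (exists x, A x /\ f x = n).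
  exists [set x]; split => //; first exact: b0.
  by move=> y [Ay fy]; apply: injf; rewrite ?inE// fx.
by exists set0; split => // y Ay; apply: nx; exists y.
Qed.

Section df.
Context d (T : measurableType d) (P : probability T R) (X : {RV P >-> R}).

Lemma df_cdfm : df X = cdfm (distribution P X).
Proof. by []. Qed.

Lemma df_nondecreasing x y : x <= y -> df X x <= df X y.
Proof. exact: (@cdfm_nondecreasing _ (distribution P X)). Qed.

Lemma df_right_continuous x : df X z @[z --> x^'+] --> df X x.
Proof.
apply: fine_cvg; rewrite fineK; last exact: fin_num_measure.
exact: cdf_right_continuous.
Qed.

(** The left limit at [x] is the mass of the open half-line below [x], which
    differs from the distribution function by the atom at [x]. *)
Lemma df_continuous_at x : distribution P X [set x] = 0%E -> {for x, continuous (df X)}.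
Proof.
move=> X0; apply/left_right_continuousP; split; last exact: df_right_continuous.
pose E n : set R := `]-oo, x - n.+1%:R^-1]%classic.
have UE : \bigcup_n E n = `]-oo, x[%classic.
  apply/seteqP; split => z.
    move=> [n _]; rewrite /E/= !in_itv/= => /le_lt_trans; apply.
    by rewrite ltrBlDr ltrDl invr_gt0.
  rewrite /= in_itv/= => zx.
  have [n nzx] := @ltr_add_invr _ z x zx.
  by exists n => //; rewrite /E/= in_itv/= lerBrDr ltW.
have cE : distribution P X (E n) @[n --> \oo] --> distribution P X (\bigcup_n E n).
  apply: nondecreasing_cvg_mu => //.
  - by move=> n; exact: measurable_itv.
  - by rewrite UE; exact: measurable_itv.
  - move=> m n mn; apply/subsetPset; apply: subset_itvl; rewrite bnd_simp.
    by rewrite lerD2l lerN2 lef_pV2 ?posrE// ler_nat.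
have dE : distribution P X `]-oo, x[%classic = distribution P X `]-oo, x]%classic.
  rewrite -(@setUitv1 _ _ _ _ true)// measureU//; last first.
    by rewrite -subset0 => z /= []; rewrite in_itv/= => + zx; rewrite zx ltxx.
  by rewrite [X in (_ + X)%E]X0 adde0.
have {cE} : df X (x - n.+1%:R^-1) @[n --> \oo] --> df X x.
  by apply: fine_cvg; rewrite fineK ?fin_num_measure//; rewrite UE dE in cE.
move=> /cvgrPdist_le cE; apply/cvgrPdist_le => e e0.
have [N _ /(_ N (leqnn _))/= HN] := cE e e0.
near=> z.
have zx : z <= x by near: z; exact: nbhs_left_le.
have Nz : x - N.+1%:R^-1 <= z.
  by near: z; apply: nbhs_left_ge; rewrite ltrBlDr ltrDl invr_gt0.
move: HN; rewrite !ger0_norm ?subr_ge0 ?df_nondecreasing//; last first.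
  by rewrite lerBlDr lerDl.
by apply: le_trans; rewrite lerD2l lerN2; exact: df_nondecreasing.
Unshelve. all: by end_near. Qed.

Lemma df_atoms_countable : countable [set x | distribution P X [set x] <> 0%E].
Proof.
apply: sub_countable (pmf_gt0_countable X); apply: subset_card_le => x /= X0.
rewrite lt_neqAle pmf_ge0 andbT eq_sym; apply/eqP => p0; apply: X0.
rewrite -[LHS]fineK ?fin_num_measure//.
by congr EFin; exact: p0.
Qed.

(** The atoms form a countable set, hence a Lebesgue-null one, which contains
    no interval. *)
Lemma continuity_point_between x y : x < y ->
  exists2 z, x < z < y & {for z, continuous (df X)}.
Proof.
move=> xy; apply: contrapT => H.
have sub : (`]x, y[ : set R) `<=` [set x | distribution P X [set x] <> 0%E].
  move=> z; rewrite /= in_itv/= => xzy z0; apply: H; exists z => //.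
  exact: df_continuous_at.
have : leb `]x, y[%classic = 0%E.
  apply: countable_lebesgue_measure0.
  by apply: sub_countable df_atoms_countable; apply: subset_card_le.
rewrite lebesgue_measure_itv/= lte_fin xy => /eqP; rewrite -EFinB eqe subr_eq0.
by rewrite gt_eqF.
Qed.

Lemma atomless_df_continuous y : {for y, continuous (df X)} -> distribution P X [set y] = 0%E.
Proof.
move=> cX; apply/eqP; rewrite eq_le measure_ge0 andbT.
apply/lee_addgt0Pr => e e0; rewrite add0e.
move: cX => /cvgrPdist_le/(_ _ e0) H.
have [z zy Hz] : exists2 z, z < y & `|df X y - df X z| <= e.
  near (y : R)^'- => z; exists z; first by near: z; exact: nbhs_left_lt.
  by near: z; apply: cvg_within H.
apply: (@le_trans _ _ (distribution P X `]z, y]%classic)).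
  rewrite le_measure ?inE// => u /= ->; by rewrite in_itv/= zy lexx.
have -> : `]z, y]%classic = `]-oo, y]%classic `\` `]-oo, z]%classic :> set R.
  apply/seteqP; split => u /=; rewrite !in_itv/=.
    by move=> /andP[zu uy]; split=> //; rewrite leNgt zu.
  by move=> [uy /negP]; rewrite -ltNge => ->.
have zy' : (`]-oo, z] : set R) `<=` `]-oo, y].
  by apply: subset_itvl; rewrite bnd_simp ltW.
rewrite measureD//; last by rewrite -ge0_fin_numE// fin_num_measure.
rewrite setIidr//.
move: Hz; rewrite -lee_fin; apply: le_trans.
rewrite ger0_norm ?subr_ge0 ?df_nondecreasing ?(ltW zy)//.
by rewrite EFinB !fineK ?fin_num_measure.
Unshelve. all: by end_near. Qed.

End df.

Lemma Rintegral_cvg d (T : measurableType d) (m : {measure set T -> \bar R}) (D : set T)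
    (f_ : nat -> T -> R) (f g : T -> R) : measurable D ->
  (forall n, measurable_fun D (f_ n)) -> measurable_fun D f ->
  {ae m, forall x, D x -> f_ ^~ x @ \oo --> f x} ->
  m.-integrable D (EFin \o g) -> (forall n x, D x -> `|f_ n x| <= g x) ->
  \int[m]_(x in D) f_ n x @[n --> \oo] --> \int[m]_(x in D) f x.
Proof.
move=> mD mf_ mf cf ig fg.
have [] := @dominated_convergence _ _ _ m D mD (fun n => EFin \o f_ n) (EFin \o f) (EFin \o g).
- by move=> n; exact/measurable_EFinP.
- exact/measurable_EFinP.
- by move: cf; apply: filterS => x cf Dx; apply: cvg_EFin; [exact: nearW|exact: cf].
- exact: ig.
- by apply: aeW => x n Dx; rewrite lee_fin fg.
move=> iF _ H; apply: fine_cvg; rewrite fineK//; exact: integrable_fin_num iF.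
Qed.

End distribution_functions.

(** * From the recursion to the fixed-point equation *)

Section lindley.
Context (R : realType).
Local Notation leb := (@lebesgue_measure R).
Context (d : measure_display) (T : measurableType d) (P : probability T R)
  (d' : measure_display) (S : measurableType d') (Q : probability S R).
Variables (mu : R) (A B W : {RV Q >-> R}) (A_ B_ W_ : nat -> {RV P >-> R}).
Hypothesis mu_gt0 : 0 < mu.
Hypothesis A_exp : has_law A (exponential_prob mu).
Hypothesis FB_cont : continuous (df B).
Hypothesis W_rec : lindley_recursion A_ B_ W_ A B.

Local Notation b := (distribution Q B).
Local Notation X := (lindley_inputs A_ B_ (W_ 0%N)).

(** The inputs that have not been used to build [W_ k]: the [A_ l] and the
    [B_ l.+1] with [k <= l]. *)
Definition future (k : nat) (i : unit + (nat + nat)) : Prop :=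
  match i with inl _ => False | inr (inl l) => (k <= l)%N | inr (inr l) => (k <= l)%N end.

Lemma B_atomless y : b [set y] = 0%E.
Proof. by apply: atomless_df_continuous; exact: FB_cont. Qed.

(* One step of the recursion uses the inputs in the order [B_ k.+1], [A_ k];
   this is the intermediate variable. *)
Let net k : {RV P >-> R} := (B_ k.+1 \- W_ k)%R.

Lemma lindley_indep k : indep_of X (W_ k) (future k).
Proof.
have [_ _ mind _ Wk] := W_rec.
elim: k => [|k IH]. exact: (@mutual_independence_indep_of _ _ _ _ _ X (inl tt)).
have indnet : indep_of X (net k) (fun i => future k i /\ i <> inr (inr k)).
  apply: (@indep_of_step _ _ _ _ _ _ (W_ k) _ _ (inr (inr k)) (fun p => p.2 - p.1)) IH _ => //=.
  exact: measurable_funB.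
have : indep_of X (W_ k.+1) (fun i => (future k i /\ i <> inr (inr k)) /\ i <> inr (inl k)).
  apply: (@indep_of_step _ _ _ _ _ _ (net k) _ _ (inr (inl k))
    (fun p => Num.max 0 (p.1 - p.2))) indnet _ => //=.
  - by apply: measurable_maxr => //; exact: measurable_funB.
  - by move=> t; rewrite Wk; congr Num.max; rewrite /net/=; ring.
apply: indep_of_sub => -[//|[l|l]] /= kl; split; [split|..] => //; try exact: ltnW.
- by move=> [lk]; rewrite lk ltnn in kl.
- by split; [exact: ltnW|move=> [lk]; rewrite lk ltnn in kl].
Qed.

Lemma product_measure_eqr (m1 m2 m3 : probability R R) (U : set (R * R)) :
  measurable U -> (forall E, measurable E -> m2 E = m3 E) ->
  (m1 \x m2)%E U = (m1 \x m3)%E U.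
Proof.
move=> mU m23; apply: eq_integral => x _ /=; apply: m23; exact: measurable_xsection.
Qed.

Lemma surv_net k y :
  surv (distribution P (net k)) y = shift_avg b (df (W_ k)) y.
Proof.
have [_ BE _ _ _] := W_rec.
apply: EFin_inj; rewrite /surv fineK ?fin_num_measure//.
rewrite -(product_gt_sub (distribution P (W_ k)) y B_atomless).
rewrite -(@product_measure_eqr _ (distribution P (B_ k.+1)) b)//; last first.
- exact: BE.
- exact: measurable_gt_sub.
rewrite -(indep_of_joint (j := inr (inr k)) (@lindley_indep k))//=; last first.
  exact: measurable_gt_sub.
by congr (P _); apply/seteqP; split => t; rewrite /= in_itv/= andbT.
Qed.

Lemma lindley_df_step k x : 0 <= x ->
  1 - df (W_ k.+1) x = exp_avg mu (shift_avg b (df (W_ k))) x.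
Proof.
move=> x0; have [AE _ _ _ Wk] := W_rec.
have -> : shift_avg b (df (W_ k)) = surv (distribution P (net k)).
  by apply/funext => y; rewrite surv_net.
have indnet : indep_of X (net k) (fun i => future k i /\ i <> inr (inr k)).
  apply: (@indep_of_step _ _ _ _ _ _ (W_ k) _ _ (inr (inr k))
    (fun p => p.2 - p.1)) (@lindley_indep k) _ => //=.
  exact: measurable_funB.
rewrite df_cdfm -survE; apply: EFin_inj; rewrite {1}/surv fineK ?fin_num_measure//.
rewrite -(@product_exponential_gt_sub _ _ mu_gt0 _ (distribution Q A)); last exact: A_exp.
rewrite -(@product_measure_eqr _ (distribution P (A_ k)) (distribution Q A))//; last first.
- exact: AE.
- exact: measurable_lt_sub.
rewrite -(indep_of_joint (j := inr (inl k)) indnet)//=; last first.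
  exact: measurable_lt_sub.
congr (P _); apply/seteqP; split => t; rewrite /= in_itv/= andbT Wk lt_max ltNge x0/=;
  by rewrite (_ : B_ k.+1 t - A_ k t - W_ k t = B_ k.+1 t - W_ k t - A_ k t)//; ring.
Qed.

Lemma lindley_df_neg k x : x < 0 -> df (W_ k) x = 0.
Proof.
have [_ _ _ W0 Wk] := W_rec; move=> x0; rewrite /df /cdf /distribution/= /pushforward.
case: k => [|k].
  move: W0 => [N [mN PN sub]].
  suff -> : P (W_ 0%N @^-1` `]-oo, x]) = 0%E by [].
  apply/eqP; rewrite -measure_le0 -PN le_measure ?inE//; first exact: measurable_funPTI.
  move=> t; rewrite /= in_itv/= => tx; apply: sub => /=; apply/negP; rewrite -ltNge.
  exact: le_lt_trans tx x0.
rewrite (_ : _ @^-1` _ = set0) ?measure0//.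
rewrite -subset0 => t /=; rewrite in_itv/= Wk ge_max => /andP[/le_lt_trans/(_ x0)].
by rewrite ltxx.
Qed.

Hypothesis W_limit : cvg_in_law W_ W.
Hypothesis surv_integrable : leb.-integrable `[0, +oo[ (EFin \o surv b).

Lemma limit_df_neg x : x < 0 -> df W x = 0.
Proof.
move=> x0; have [z /andP[xz z0] cz] := continuity_point_between W x0.
have : df W z = 0.
  apply: (cvg_unique _ (W_limit cz)) => //.
  rewrite (_ : (fun k => _) = (fun=> 0)); first exact: cvg_cst.
  by apply/funext => k; exact: lindley_df_neg.
move=> Wz; apply/eqP; rewrite eq_le cdfm_ge0 andbT -Wz.
exact: df_nondecreasing (ltW xz).
Qed.

(** Convergence in law gives [df (W_ k) (s - y)] for every [s] such that [s - y]
    is not an atom of [W]; the exceptional [s] are countably many, hence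
    negligible for the atomless [b]. *)
Lemma shift_avg_limit y :
  shift_avg b (df (W_ k)) y @[k --> \oo] --> shift_avg b (df W) y.
Proof.
apply: (@Rintegral_cvg _ _ _ _ _ _ _ (fun=> 1)) => //.
- move=> k; apply: (measurableT_comp (@measurable_cdfm _ (distribution P (W_ k)) setT)).
  exact: measurable_funB.
- by apply: (measurableT_comp (@measurable_cdfm _ (distribution Q W) setT)); exact: measurable_funB.
- have : b.-negligible ((fun u => u + y) @` [set x | distribution Q W [set x] <> 0%E]).
    apply: atomless_countable_negligible; first exact: B_atomless.
    exact: sub_countable (card_image_le _ _) (@df_atoms_countable _ _ _ _ W).
  apply: negligibleS => s /= H; apply: contrapT => H'; apply: H => _.
  apply: W_limit; apply: df_continuous_at; apply: contrapT => W0; apply: H'.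
  by exists (s - y) => //; rewrite subrK.
- exact: finite_measure_integrable_cst.
- by move=> k s _; exact: cdfm_norm.
Qed.

Lemma exp_avg_limit x : 0 <= x ->
  exp_avg mu (shift_avg b (df (W_ k))) x @[k --> \oo] --> exp_avg mu (shift_avg b (df W)) x.
Proof.
move=> x0; apply: cvgM; first exact: cvg_cst.
have isurv := integrable_itvcy x0 surv_integrable.
apply: (@Rintegral_cvg _ _ _ leb `[x, +oo[%classic
  (fun k s => expR (- mu * (s - x)) * shift_avg b (df (W_ k)) s)
  (fun s => expR (- mu * (s - x)) * shift_avg b (df W) s) (surv b)) => //.
- move=> k; apply: measurable_funM; first exact: measurable_expR_discount.
  apply: (@measurable_shift_avg _ b _ _ 1).
    exact: (@measurable_cdfm _ (distribution P (W_ k))).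
  exact: cdfm_norm.
- apply: measurable_funM; first exact: measurable_expR_discount.
  apply: (@measurable_shift_avg _ b _ _ 1); first exact: (@measurable_cdfm _ (distribution Q W)).
  exact: cdfm_norm.
- apply: aeW => s _; apply: cvgM; [exact: cvg_cst|exact: shift_avg_limit].
- move=> k s /=; rewrite in_itv/= andbT => xs; rewrite normrM.
  apply: (@le_trans _ _ (1 * `|shift_avg b (df (W_ k)) s|)).
    by rewrite ler_wpM2r// ger0_norm ?expR_ge0// expR_discount_le1.
  rewrite mul1r -[leRHS]mul1r; apply: shift_avg_bound.
  + exact: B_atomless.
  + exact: (@measurable_cdfm _ (distribution P (W_ k))).
  + by move=> z z0; exact: lindley_df_neg.
  + by move=> z _; exact: cdfm_norm.
Qed.

Lemma lindley_df_limit x : 0 <= x ->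
  df (W_ k.+1) x @[k --> \oo] --> 1 - exp_avg mu (shift_avg b (df W)) x.
Proof.
move=> x0; rewrite (_ : (fun k => _) = (fun k => 1 - exp_avg mu (shift_avg b (df (W_ k))) x)).
  by apply: cvgB; [exact: cvg_cst|exact: exp_avg_limit].
by apply/funext => k; rewrite -lindley_df_step// subKr.
Qed.

(** The distribution functions of the [W_ k] converge at every nonnegative
    point, but their limit is known to be [df W] at continuity points only.
    These are dense, and both sides are continuous from the right: the left one
    as a distribution function, the right one because its density is at most
    [mu]. *)
Lemma lindley_limit_fixed_point : fixed_point b mu (df W).
Proof.
have mF : measurable_fun setT (df W) by exact: (@measurable_cdfm _ (distribution Q W)).
have FM x : `|df W x| <= 1 by exact: (cdfm_norm (distribution Q W)).
split; [exact: mF|by exists 1|exact: limit_df_neg|].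
pose t := shift_avg b (df W); pose V := exp_avg mu t.
have tM s : `|t s| <= surv b s.
  rewrite -[leRHS]mul1r; apply: shift_avg_bound => //; first exact: B_atomless.
  exact: limit_df_neg.
have it : leb.-integrable `[0, +oo[ (EFin \o t).
  apply: (le_integrable _ _ _ surv_integrable) => //.
    by apply/measurable_EFinP; exact: (@measurable_shift_avg _ b _ _ 1).
  by move=> s _ /=; rewrite lee_fin [leRHS]ger0_norm// surv_ge0.
have t0 s : 0 <= t s by apply: Rintegral_ge0 => u _; exact: (cdfm_ge0 (distribution Q W)).
have V0 x : 0 <= x -> 0 <= V x.
  move=> x0; rewrite /V /exp_avg mulr_ge0 ?(ltW mu_gt0)//.
  by apply: Rintegral_ge0 => s _; rewrite mulr_ge0 ?expR_ge0.
have V_lipschitz x y : 0 <= x -> x <= y -> V x - V y <= mu * (y - x).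
  move=> x0 xy; have itx := integrable_itvcy x0 it.
  rewrite -integral_exp_tail_co// ler_wpM2l ?(ltW mu_gt0)//.
  have -> : y - x = \int[leb]_(s in `[x, y[) 1.
    rewrite Rintegral_cst//= mul1r lebesgue_measure_itv/= lte_fin.
    by case: ltgtP xy => // -> _; rewrite subrr.
  apply: le_Rintegral => //.
  - apply: integrableS (integrable_exp_tail mu_gt0 itx) => //; exact: subset_itvl.
  - apply: (@integrable_bounded _ _ _ _ _ _ 1) => //; last by move=> s _; rewrite normr1.
    by rewrite /= lebesgue_measure_itv/=; case: ifP => _; rewrite -?EFinB ltry.
  - move=> s /=; rewrite in_itv/= => /andP[xs _]; rewrite exp_tailE.
    have := V0 s (le_trans x0 xs); rewrite -/(V s).
    have := ler_norm (t s); have := tM s; have := surv_le1 b s; lra.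
have FV y : 0 <= y -> {for y, continuous (df W)} -> df W y = 1 - V y.
  move=> y0 cy; apply: (cvg_unique _ _ (lindley_df_limit y0)) => //.
  by have := W_limit cy; rewrite -(cvg_shiftS (fun k => df (W_ k) y)).
move=> x x0; rewrite -/(V x); apply/eqP.
rewrite subr_eq addrC -subr_eq eq_sym -/(V x) eq_le; apply/andP; split.
  apply/ler_addgt0Pl => e e0.
  have xe : x < x + e / mu by rewrite ltrDl divr_gt0.
  have [y /andP[xy ye] cy] := continuity_point_between W xe.
  apply: (le_trans (df_nondecreasing W (ltW xy))).
  rewrite FV ?(le_trans x0 (ltW xy))//.
  have := V_lipschitz _ _ x0 (ltW xy).
  have : mu * (y - x) <= e by rewrite mulrC -ler_pdivlMr// lerBlDl ltW.
  lra.
apply/ler_addgt0Pl => e e0.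
have := @df_right_continuous _ _ _ _ W x => /cvgrPdist_le/(_ _ e0) H.
have [z xz Hz] : exists2 z, x < z & forall y, x < y < z -> `|df W x - df W y| <= e.
  have [z z0 Hz] := H.
  exists (x + z); first by rewrite ltrDl.
  move=> y /andP[xy yz]; apply: Hz => //=.
  by rewrite distrC ger0_norm ?subr_ge0 ?(ltW xy)// ltrBlDl.
have [y xyz cy] := continuity_point_between W xz.
have xy : x <= y by case/andP: xyz => /ltW.
have y0 := le_trans x0 xy.
have h1 : 1 - V x <= 1 - V y.
  apply: (ler_cvg_to (lindley_df_limit x0) (lindley_df_limit y0)).
  by apply: nearW => k; exact: df_nondecreasing.
have := Hz y xyz; rewrite distrC ger0_norm ?subr_ge0 ?df_nondecreasing// (FV y)//.
move: h1; lra.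
Qed.

End lindley.

(** * The linear system and the fixed-point equation *)

Section linear_system.
Context (R : realType).
Local Notation leb := (@lebesgue_measure R).
Variables (b : probability R R) (mu : R).
Hypothesis b_atomless : forall y, b [set y] = 0%E.
Hypothesis mu_gt0 : 0 < mu.

(** The law with distribution function [F] has mass [F 0] at zero and density
    [mu * exp_tail mu t] on the positive reals; both sides are
    [P(B >= y + W)]. *)
Lemma shift_avg_exp_avg (F t : R -> R) (y : R) :
  measurable_fun setT F -> (exists M : R, forall x : R, `|F x| <= M) ->
  (forall x, x < 0 -> F x = 0) ->
  leb.-integrable `[0, +oo[ (EFin \o t) ->
  (forall x, 0 <= x -> 1 - F x = exp_avg mu t x) ->
  shift_avg b F y = F 0 * surv b y +
    \int[leb]_(w in `[0, +oo[) (surv b (y + w) * (mu * exp_tail mu t w)).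
Proof.
move=> mF [M FM] F0 it FE.
rewrite integral_surv_exp_tail// /surv.
have bE := esym (atomless_itv_bndy b_atomless y).
have fb : (b setT < +oo)%E by rewrite -ge0_fin_numE// fin_num_measure.
have ic : b.-integrable setT (EFin \o ((fun=> F 0) \_ `[y, +oo[)).
  apply: (@integrable_bounded _ _ _ _ _ _ `|F 0|) => //.
    by apply/(measurable_restrictT _ _).1.
  by move=> s _; rewrite patchE; case: ifP => _; rewrite ?normr0.
have iF := integrable_shift b y mF FM.
have E s : (if y <= s then exp_avg mu t 0 - exp_avg mu t (s - y) else 0) =
    F (s - y) - ((fun=> F 0) \_ `[y, +oo[) s.
  have [ys|sy] := leP y s.
    by rewrite restrict_itvcy// -!FE ?subr_ge0//; ring.
  by rewrite restrict_itvcy0// F0 ?subr_lt0// subrr.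
under [in RHS]eq_Rintegral do rewrite E.
rewrite RintegralB// bE -(Rintegral_cst b)// Rintegral_mkcond.
by rewrite addrCA subrr addr0.
Qed.

Variables (n : nat) (g h : 'I_n -> R -> R).
Hypothesis g_int : forall i, leb.-integrable `[0, +oo[ (EFin \o g i).
Hypothesis h_meas : forall i, measurable_fun (`[0, +oo[ : set R) (h i).
Hypothesis h_bnd : forall i, exists M : R, forall x : R, 0 <= x -> `|h i x| <= M.
Hypothesis surv_gh : forall x y : R, 0 <= x -> 0 <= y ->
  surv b (x + y) = \sum_(i < n) g i x * h i y.

Lemma surv_integrable : leb.-integrable `[0, +oo[ (EFin \o surv b).
Proof.
have ig0 : leb.-integrable `[0, +oo[ (EFin \o (fun x => \sum_(i < n) h i 0 * g i x)).
  exact: integrable_lincomb.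
apply: (le_integrable _ _ _ ig0) => //.
  by apply/measurable_EFinP; exact: measurable_surv.
move=> x /=; rewrite in_itv/= andbT => x0; rewrite -[in leLHS](addr0 x) surv_gh//.
by under eq_bigr do rewrite mulrC.
Qed.

Definition h_moment (t : R -> R) (i : 'I_n) : R :=
  \int[leb]_(x in `[0, +oo[) (h i x * exp_tail mu t x).

Let integrable_h_tail t i : leb.-integrable `[0, +oo[ (EFin \o t) ->
  leb.-integrable `[0, +oo[ (EFin \o (fun x => h i x * exp_tail mu t x)).
Proof.
move=> it; have [M hM] := h_bnd i.
apply: (@integrable_bounded_mul _ _ _ _ _ _ _ M) => //.
- exact: h_meas.
- by move=> x /=; rewrite in_itv/= andbT; exact: hM.
- exact: integrable_exp_tail.
Qed.

Lemma integral_surv_sum t y : leb.-integrable `[0, +oo[ (EFin \o t) -> 0 <= y ->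
  \int[leb]_(w in `[0, +oo[) (surv b (y + w) * (mu * exp_tail mu t w)) =
  \sum_(i < n) (mu * h_moment t i) * g i y.
Proof.
move=> it y0.
transitivity (\int[leb]_(w in `[0, +oo[) \sum_(i < n) (mu * g i y) * (h i w * exp_tail mu t w)).
  apply: eq_Rintegral => w; rewrite inE/= in_itv/= andbT => w0.
  by rewrite surv_gh// mulr_suml; apply: eq_bigr => i _; ring.
rewrite Rintegral_sum//; last by move=> i; apply: integrable_scale => //; exact: integrable_h_tail.
apply: eq_bigr => i _; rewrite RintegralZl//; last exact: integrable_h_tail.
by rewrite /h_moment; ring.
Qed.

(** For a solution of the system, the exponential average of this function is
    the tail of [W]. *)
Definition source (pi0 : R) (c : 'I_n -> R) (s : R) : R :=
  pi0 * surv b s + \sum_(i < n) c i * g i s.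

Lemma integrable_source pi0 c : leb.-integrable `[0, +oo[ (EFin \o source pi0 c).
Proof.
apply: integrable_add => //; last exact: integrable_lincomb.
by apply: integrable_scale => //; exact: surv_integrable.
Qed.

Lemma exp_avg_source pi0 c x : 0 <= x ->
  exp_avg mu (source pi0 c) x =
  pi0 * exp_avg mu (surv b) x + \sum_(i < n) c i * exp_avg mu (g i) x.
Proof.
move=> x0; have isx := integrable_itvcy x0 surv_integrable.
have igx i := integrable_itvcy x0 (g_int i).
rewrite /source exp_avgD//; last 2 first.
- exact: integrable_scale.
- exact: integrable_lincomb.
by rewrite exp_avgZ// exp_avg_sum.
Qed.

Lemma h_moment_source pi0 c i :
  h_moment (source pi0 c) i =
  pi0 * h_moment (surv b) i + \sum_(j < n) c j * h_moment (g j) i.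
Proof.
rewrite /h_moment -RintegralZl//; last by apply: integrable_h_tail; exact: surv_integrable.
transitivity (\int[leb]_(x in `[0, +oo[) (pi0 * (h i x * exp_tail mu (surv b) x) +
   \sum_(j < n) c j * (h i x * exp_tail mu (g j) x))).
  apply: eq_Rintegral => x; rewrite inE/= in_itv/= andbT => x0.
  rewrite exp_tailE exp_avg_source// /source !exp_tailE.
  under [in RHS]eq_bigr do rewrite mulrCA exp_tailE mulrBr.
  rewrite -mulr_sumr sumrB; ring.
rewrite RintegralD//; last 2 first.
- by apply: integrable_scale => //; apply: integrable_h_tail; exact: surv_integrable.
- by apply: integrable_lincomb => // j; exact: integrable_h_tail.
rewrite Rintegral_sum//; last by move=> j; apply: integrable_scale => //; exact: integrable_h_tail.
by congr (_ + _); apply: eq_bigr => j _; rewrite RintegralZl//; exact: integrable_h_tail.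
Qed.

Lemma mu_laplace t : mu * laplace t mu = exp_avg mu t 0.
Proof.
by rewrite /laplace /exp_avg; congr (_ * _); apply: eq_Rintegral => s _; rewrite subr0.
Qed.

(** The system without the expansion by linearity: total mass 1, and [c i] is
    the integral of [h i] against the density that [source pi0 c] defines. *)
Lemma linear_systemE pi0 c : linear_system mu (surv b) g h pi0 c <->
  1 - pi0 = exp_avg mu (source pi0 c) 0 /\
  forall i, c i = mu * h_moment (source pi0 c) i.
Proof.
have E1 : pi0 + mu * pi0 * laplace (surv b) mu + mu * \sum_(i < n) c i * laplace (g i) mu =
    pi0 + exp_avg mu (source pi0 c) 0.
  rewrite exp_avg_source// -mu_laplace -addrA; congr (_ + (_ + _)); first ring.
  by rewrite mulr_sumr; apply: eq_bigr => i _; rewrite -mu_laplace mulrCA.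
have E2 i : mu * pi0 * h_moment (surv b) i + mu * \sum_(j < n) c j * h_moment (g j) i =
    mu * h_moment (source pi0 c) i by rewrite h_moment_source; ring.
rewrite /linear_system E1; split => -[H1 H2]; split.
- by rewrite -H1 addrC addKr.
- by move=> i; rewrite -E2; exact: H2.
- by rewrite -H1 subrKC.
- by move=> i; rewrite [LHS]H2 -E2.
Qed.

Lemma fixed_point_solution F : fixed_point b mu F ->
  exists c, linear_system mu (surv b) g h (F 0) c.
Proof.
move=> fF; have it := shift_avg_integrable b_atomless surv_integrable fF.
have [mF FM F0 FE] := fF; pose t := shift_avg b F.
exists (fun i => mu * h_moment t i); apply/linear_systemE.
have tE s : 0 <= s -> source (F 0) (fun i => mu * h_moment t i) s = t s.
  by move=> s0; rewrite /t (shift_avg_exp_avg _ mF FM F0 it FE) integral_surv_sum.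
have avgE x : 0 <= x -> exp_avg mu (source (F 0) (fun i => mu * h_moment t i)) x = exp_avg mu t x.
  by move=> x0; apply: eq_exp_avg => s xs; rewrite tE// (le_trans x0).
split; first by rewrite avgE// FE.
move=> i; apply: (congr1 (fun v => mu * v)); apply: eq_Rintegral => x.
by rewrite inE/= in_itv/= andbT => x0; rewrite !exp_tailE avgE// tE.
Qed.

Lemma solution_fixed_point pi0 c : linear_system mu (surv b) g h pi0 c ->
  fixed_point b mu ((fun x => 1 - exp_avg mu (source pi0 c) x) \_ `[0, +oo[).
Proof.
move=> /linear_systemE[H1 H2]; set t := source pi0 c; set F := _ \_ _.
have it : leb.-integrable `[0, +oo[ (EFin \o t) := integrable_source pi0 c.
have mF : measurable_fun setT F.
  apply/(measurable_restrictT _ _).1 => //; apply: measurable_funB => //.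
  by apply/measurable_EFinP; exact: measurable_int (integrable_exp_avg mu_gt0 it).
have FM : exists M, forall x, `|F x| <= M.
  exists (1 + mu * \int[leb]_(s in `[0, +oo[) `|t s|) => x.
  have I0 : 0 <= \int[leb]_(s in `[0, +oo[) `|t s| by exact: Rintegral_ge0.
  have [x0|x0] := leP 0 x; last first.
    by rewrite /F restrict_itvcy0// normr0 addr_ge0// mulr_ge0// ltW.
  rewrite /F restrict_itvcy//; apply: le_trans (ler_normB _ _) _.
  rewrite normr1 lerD2l; have itx := integrable_itvcy x0 it.
  apply: le_trans (exp_avg_norm mu_gt0 itx) _.
  rewrite /exp_avg ler_wpM2l ?(ltW mu_gt0)//.
  have intn := integrable_norm itx.
  apply: (@le_trans _ _ (\int[leb]_(s in `[x, +oo[) `|t s|)).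
    apply: le_Rintegral => //; first exact: integrable_discounted.
    move=> s /=; rewrite in_itv/= andbT => xs.
    by rewrite ler_piMl// expR_discount_le1.
  rewrite /Rintegral fine_le//.
  - exact: (integrable_fin_num _ intn).
  - exact: (integrable_fin_num _ (integrable_norm it)).
  apply: ge0_subset_integral => //; first by have := measurable_int _ (integrable_norm it).
  exact: subset_itvcy.
have F0 x : x < 0 -> F x = 0 by move=> x0; rewrite /F restrict_itvcy0.
have FE x : 0 <= x -> 1 - F x = exp_avg mu t x.
  by move=> x0; rewrite /F restrict_itvcy// opprB addrCA subrr addr0.
have Fpi0 : F 0 = pi0 by rewrite /F restrict_itvcy// -H1 opprB addrCA subrr addr0.
split => // x x0; rewrite FE//; apply: eq_exp_avg => s /(le_trans x0) s0.
rewrite (shift_avg_exp_avg _ mF FM F0 it FE) integral_surv_sum// Fpi0.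
by rewrite {1}/t /source; congr (_ + _); apply: eq_bigr => i _; rewrite -H2.
Qed.

End linear_system.

Theorem theorem2 (R : realType)
  (d : measure_display) (T : measurableType d) (P : probability T R)
  (d' : measure_display) (S : measurableType d') (Q : probability S R)
  (mu : R) (A B W : {RV Q >-> R}) (A_ B_ W_ : nat -> {RV P >-> R})
  (n : nat) (g h : 'I_n -> R -> R)
  (mu_gt0 : 0 < mu)
  (A_exp : has_law A (exponential_prob mu))
  (B_ge0 : {ae Q, forall t, 0 <= B t})
  (AB_indep : independent2 A B)
  (FB_cont : continuous (df B))
  (n_gt0 : (0 < n)%N)
  (FB_classM : class_M_decomposition g h (df B))
  (h_bounded : forall i, exists M : R, forall x, 0 < x -> `|h i x| <= M)
  (g_integrable : forall i,
    (\int[@lebesgue_measure R]_(x in `[0%R, +oo[) `|g i x|%:E < +oo)%E)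
  (W_rec : lindley_recursion A_ B_ W_ A B)
  (W_limit : cvg_in_law W_ W) :
  let Fbar := fun x => 1 - df B x in
  (exists (pi0 : R) (c : 'I_n -> R), linear_system mu Fbar g h pi0 c) /\
  (forall (pi0 : R) (c : 'I_n -> R), linear_system mu Fbar g h pi0 c ->
    forall x, 0 <= x ->
      df W x = 1 - expR (mu * x) *
        \int[@lebesgue_measure R]_(s in `[x, +oo[)
          (expR (- mu * s) *
            (mu * pi0 * Fbar s + mu * \sum_(i < n) c i * g i s))).
Proof.
pose b : probability R R := distribution Q B.
have [mg mh FBgh] := FB_classM.
have FbarE : (fun x => 1 - df B x) = surv b by apply/funext => x; rewrite survE.
move=> Fbar; rewrite /Fbar FbarE {Fbar}.
have b0 y : b [set y] = 0%E by exact: B_atomless FB_cont y.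
have g_int i : (@lebesgue_measure R).-integrable `[0, +oo[ (EFin \o g i).
  by apply/integrableP; split; [by apply/measurable_EFinP; exact: mg|exact: g_integrable].
have h_bnd i : exists M, forall x, 0 <= x -> `|h i x| <= M.
  have [M hM] := h_bounded i; exists (Num.max M `|h i 0|) => x.
  by rewrite le_eqVlt le_max => /predU1P[<-|/hM->//]; rewrite lexx orbT.
have gh x y : 0 <= x -> 0 <= y -> surv b (x + y) = \sum_(i < n) g i x * h i y.
  by move=> x0 y0; rewrite -FBgh// -FbarE.
have isurv := surv_integrable g_int gh.
have fpW := lindley_limit_fixed_point mu_gt0 A_exp FB_cont W_rec W_limit isurv.
split.
  exists (df W 0).
  by have := fixed_point_solution b0 mu_gt0 g_int mh h_bnd gh fpW.
move=> pi0 c sol x x0.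
have fpG := solution_fixed_point b0 mu_gt0 g_int mh h_bnd gh sol.
rewrite (fixed_point_unique b0 mu_gt0 isurv fpW fpG) restrict_itvcy//.
rewrite exp_avg_expE//; last first.
  by apply: integrable_itvcy x0 _; exact: (integrable_source g_int gh).
congr (1 - _ * _); apply: eq_Rintegral => s _; congr (_ * _).
by rewrite /source survE mulrDr mulrA.
Qed.
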